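(* Let $(M,g_L,Z,\lambda,\rho)$ be a Lyra almost Ricci--Bourguignon soliton on a connected Lyra twisted warped product $M=M_1\times_fM_2$ of dimension $n\ge3$. Then the following are equivalent: (1) $Z$ is Lyra conformal; (2) $g_L$ is an Einstein metric. More precisely, if $\mathcal L_Zg_L=2\psi g_L$ with $\psi\in C^\infty(M)$, then $$\operatorname{Ric}^L=\mu g_L,\qquad \mu=\lambda+\rho R^L-\psi,$$ where $\mu$ is constant; moreover $$R^L=n\mu\qquad\text{and}\qquad \lambda=(1-n\rho)\mu+\psi .$$
   Context: Lyra twisted warped product: $(M_1,g_1),(M_2,g_2)$ are smooth pseudo-Riemannian manifolds of positive dimensions $n_1,n_2$, $n=n_1+n_2$; $f,\varphi:M_1\times M_2\to(0,\infty)$ are smooth; $M=M_1\times M_2$ carries $g=g_1\oplus f^2g_2$ and $g_L=\varphi^2g$. $\operatorname{Ric}^L,R^L$ are the Ricci tensor and scalar curvature of $g_L$. A Lyra almost Ricci--Bourguignon soliton is $(g_L,Z,\lambda,\rho)$ with $Z$ a smooth vector field on $M$, $\lambda\in C^\infty(M)$, $\rho\in\mathbb R$, satisfying $\operatorname{Ric}^L+\frac12\mathcal L_Zg_L=(\lambda+\rho R^L)g_L$. $Z$ is Lyra conformal if $\mathcal L_Zg_L=2\psi g_L$ for some $\psi\in C^\infty(M)$. $g_L$ is Einstein if $\operatorname{Ric}^L=\mu g_L$ for some constant $\mu\in\mathbb R$. *)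

(* Defs.v *)
From HB Require Import structures.
From mathcomp Require Import all_boot all_order all_algebra.
From mathcomp Require Import all_classical all_reals all_analysis.

Set Implicit Arguments.
Unset Strict Implicit.
Unset Printing Implicit Defensive.

Import Order.TTheory GRing.Theory Num.Theory.
Import numFieldNormedType.Exports.

Local Open Scope classical_set_scope.
Local Open Scope ring_scope.

Definition evec (R : realType) (n : nat) (i : 'I_n) : 'rV[R]_n := delta_mx 0 i.

(** [Ck U k h]: [h] is of class C^k on the open set [U] of R^n. *)
Fixpoint Ck (R : realType) (n : nat) (U : set 'rV[R]_n) (k : nat)
    (h : 'rV[R]_n -> R) : Prop :=
  {in U, continuous h} /\
  if k is k'.+1 then
    forall i : 'I_n, (forall x, U x -> derivable h x (evec R i)) /\
                     Ck U k' (fun x => 'D_(evec R i) h x)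
  else True.

Definition smooth_on (R : realType) (n : nat) (U : set 'rV[R]_n)
    (h : 'rV[R]_n -> R) : Prop := forall k, Ck U k h.

(** An atlas (not required to be maximal) of R^n-valued charts.
    [coord c] and [icoord c] are total functions; they are only meaningful on
    [dom c] and on [coord c @` dom c] respectively. *)
Record atlas (R : realType) (n : nat) (M : topologicalType) := Atlas {
  chart : Type ;
  dom : chart -> set M ;
  coord : chart -> M -> 'rV[R]_n ;
  icoord : chart -> 'rV[R]_n -> M
}.

Section Manifold.
Variables (R : realType) (n : nat) (M : topologicalType) (A : atlas R n M).

Definition cod (c : chart A) : set 'rV[R]_n := coord c @` dom c.

Record smooth_manifold : Prop := SmoothManifold {
  manifold_hausdorff : hausdorff_space M ;
  manifold_second_countable : @second_countable M ;
  manifold_cover : forall p : M, exists c : chart A, dom c p ;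
  open_dom : forall c : chart A, open (dom c) ;
  open_cod : forall c : chart A, open (cod c) ;
  coordK : forall c : chart A, {in dom c, cancel (coord c) (icoord c)} ;
  coord_continuous : forall c : chart A, {in dom c, continuous (coord c)} ;
  icoord_continuous : forall c : chart A, {in cod c, continuous (icoord c)} ;
  smooth_transition : forall (c d : chart A) (i : 'I_n),
    smooth_on (coord c @` (dom c `&` dom d))
              (fun x => coord d (icoord c x) 0 i)
}.

Definition smooth_in_chart (c : chart A) (F : M -> R) : Prop :=
  smooth_on (cod c) (F \o icoord c).

Definition smooth_fun (F : M -> R) : Prop :=
  forall c : chart A, smooth_in_chart c F.

(** The coordinate derivative of [F] in the chart [c] at [p]. *)
Definition pd (c : chart A) (i : 'I_n) (F : M -> R) (p : M) : R :=
  'D_(evec R i) (F \o icoord c) (coord c p).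

(** Entry (i, j) is the derivative of the j-th coordinate of [d] with respect
    to the i-th coordinate of [c]. *)
Definition jacobian (c d : chart A) (p : M) : 'M[R]_n :=
  \matrix_(i, j) pd c i (fun q => coord d q 0 j) p.

(** Vector fields and (0,2)-tensor fields are given by their components in
    every chart of the atlas; the values of the components in the chart [c] are
    meaningless outside [dom c]. *)
Definition vcomp := chart A -> M -> 'rV[R]_n.
Definition tcomp := chart A -> M -> 'M[R]_n.

Definition smooth_vector_field (Z : vcomp) : Prop :=
  (forall c d p, dom c p -> dom d p -> Z d p = Z c p *m jacobian c d p) /\
  (forall c i, smooth_in_chart c (fun p => Z c p 0 i)).

Definition tensor_field (T : tcomp) : Prop :=
  forall c d p, dom c p -> dom d p ->
    T c p = jacobian c d p *m T d p *m (jacobian c d p)^T.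

(** The index (signature) of a nondegenerate symmetric tensor field is locally
    constant, hence constant on a connected manifold: it is not imposed
    separately. *)
Record pseudo_metric (g : tcomp) : Prop := PseudoMetric {
  metric_tensor : tensor_field g ;
  metric_smooth : forall c i j, smooth_in_chart c (fun p => g c p i j) ;
  metric_sym : forall c p, dom c p -> (g c p)^T = g c p ;
  metric_nondeg : forall c p, dom c p -> g c p \in unitmx
}.

Definition tensor_eq (S T : tcomp) : Prop :=
  forall c p, dom c p -> S c p = T c p.

(** Christoffel symbol with upper index [k] and lower indices [i], [j]. *)
Definition christoffel (g : tcomp) (c : chart A) (k i j : 'I_n) (p : M) : R :=
  2^-1 * \sum_(l < n) invmx (g c p) k l *
    (pd c i (fun q => g c q j l) p + pd c j (fun q => g c q i l) p
     - pd c l (fun q => g c q i j) p).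

(** The component along the k-th coordinate field of
    R(d_i, d_j) d_l = D_i D_j d_l - D_j D_i d_l. *)
Definition riemann (g : tcomp) (c : chart A) (k l i j : 'I_n) (p : M) : R :=
  pd c i (christoffel g c k j l) p - pd c j (christoffel g c k i l) p
  + \sum_(m < n) (christoffel g c k i m p * christoffel g c m j l p
                  - christoffel g c k j m p * christoffel g c m i l p).

Definition ricci (g : tcomp) : tcomp := fun c p =>
  \matrix_(j, l) \sum_(k < n) riemann g c k l k j p.

(** A scalar field in components: for a metric tensor the value at [p] is the same
    in every chart [c] whose domain contains [p]. *)
Definition scalar_curv (g : tcomp) (c : chart A) (p : M) : R :=
  \sum_(i < n) \sum_(j < n) invmx (g c p) i j * ricci g c p i j.

(** The Lie derivative of [g] along [Z]. *)
Definition lie_derivative (Z : vcomp) (g : tcomp) : tcomp := fun c p =>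
  \matrix_(i, j) \sum_(k < n)
    (Z c p 0 k * pd c k (fun q => g c q i j) p
     + g c p k j * pd c i (fun q => Z c q 0 k) p
     + g c p i k * pd c j (fun q => Z c q 0 k) p).

Definition scale_tensor (F : M -> R) (T : tcomp) : tcomp :=
  fun c p => F p *: T c p.

Definition einstein (g : tcomp) : Prop :=
  exists mu : R, tensor_eq (ricci g) (scale_tensor (fun=> mu) g).

Definition conformal_factor (g : tcomp) (Z : vcomp) (psi : M -> R) : Prop :=
  smooth_fun psi /\
  tensor_eq (lie_derivative Z g) (scale_tensor (fun p => 2 * psi p) g).

Definition conformal (g : tcomp) (Z : vcomp) : Prop :=
  exists psi : M -> R, conformal_factor g Z psi.

Record almost_ricci_bourguignon_soliton (g : tcomp) (Z : vcomp)
    (lambda : M -> R) (rho : R) : Prop := ARBSoliton {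
  soliton_field : smooth_vector_field Z ;
  soliton_fun : smooth_fun lambda ;
  soliton_eq : forall c p, dom c p ->
    ricci g c p + 2^-1 *: lie_derivative Z g c p =
    (lambda p + rho * scalar_curv g c p) *: g c p
}.

End Manifold.

Section TwistedProduct.
Variables (R : realType) (n1 n2 : nat) (M1 M2 : topologicalType).
Variables (A1 : atlas R n1 M1) (A2 : atlas R n2 M2).

Definition prod_atlas : atlas R (n1 + n2) (M1 * M2)%type :=
  @Atlas R (n1 + n2) (M1 * M2)%type (chart A1 * chart A2)%type
    (fun c => dom c.1 `*` dom c.2)
    (fun c p => row_mx (coord c.1 p.1) (coord c.2 p.2))
    (fun c x => (icoord c.1 (lsubmx x), icoord c.2 (rsubmx x))).

(** g1 + f^2 g2 *)
Definition twisted_product (g1 : tcomp A1) (g2 : tcomp A2)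
    (f : M1 * M2 -> R) : tcomp prod_atlas := fun c p =>
  block_mx (g1 c.1 p.1) 0 0 (f p ^+ 2 *: g2 c.2 p.2).

(** phi^2 (g1 + f^2 g2) *)
Definition lyra_metric (g1 : tcomp A1) (g2 : tcomp A2)
    (f phi : M1 * M2 -> R) : tcomp prod_atlas :=
  scale_tensor (fun p => phi p ^+ 2) (twisted_product g1 g2 f).

End TwistedProduct.

(* Main.v *)
Require Import Defs.
From HB Require Import structures.
From mathcomp Require Import all_boot all_order all_algebra.
From mathcomp Require Import all_classical all_reals all_analysis.
From mathcomp Require Import ring lra.
Import Order.TTheory GRing.Theory Num.Theory.
Import numFieldNormedType.Exports.
Local Open Scope classical_set_scope.
Local Open Scope ring_scope.
Set Implicit Arguments.
Unset Strict Implicit.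
Unset Printing Implicit Defensive.

(** If L_Z g = 2 psi g, the soliton equation reads Ric = mu g with
    mu = lambda + rho R - psi, so the content is Schur's lemma in dimension n >= 3.
    In a chart the curvature is the matrix-valued form F_ij = d_i W_j - d_j W_i + [W_i, W_j],
    where (W_i)^k_l = Gamma^k_il; the second Bianchi identity follows from d_m d_i W_j = d_i d_m W_j
    and its double contraction gives (n - 2) d_m mu = 0.  Hence mu is locally constant in every
    chart.  Since Ric is a tensor, the values of mu in two charts agree on their overlap, and
    connectedness makes mu globally constant.  Tensoriality comes from the gauge transformation
    K W_i = d_i K + V_i K, with K the Jacobian of the transition map and V_i the pulled-back
    connection, which determines the Levi-Civita connection by uniqueness.  Conversely, if
    Ric = mu g then R = n mu and the soliton equation says L_Z g = 2 (lambda + rho n mu - mu) g. *)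

(** * Functions of class C^k *)

(** Curvature is defined by index formulas in charts. Once the Christoffel symbols are packed into
    matrices, each classical identity becomes an identity between noncommutative polynomials in
    which the derivatives of the [W_i] are free letters. Analysis then has to supply only the
    product rule, the chain rule and the symmetry of second partial derivatives. The regularity
    budget is finite: a metric and transition maps of class C^3 give connections and Jacobians of
    class C^2 and a curvature of class C^1, which leaves exactly the one derivative that the Bianchi
    identity takes. The factor mu enters Schur's argument as a bare function of chart and point. It
    is shown to be differentiable because n mu is the trace of Ric, and independent of the chart
    because Ric and g transform alike. The metric may be indefinite, so every trace is taken with
    the inverse matrix and the arguments rest on nondegeneracy alone. *)

Section Ck.
Variables (R : realType) (n : nat).
Implicit Types (U V : set 'rV[R]_n) (h g : 'rV[R]_n -> R) (i j : 'I_n) (k : nat).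

Definition pder i h : 'rV[R]_n -> R := fun x => 'D_(evec R i) h x.

Lemma Ck_continuous U k h x : Ck U k h -> U x -> {for x, continuous h}.
Proof. by case: k => [|k] [+ _] Ux; apply; rewrite inE. Qed.

Lemma CkSP U k h : Ck U k.+1 h <->
  (forall x, U x -> {for x, continuous h}) /\
  forall i, (forall x, U x -> derivable h x (evec R i)) /\ Ck U k (pder i h).
Proof.
split=> [[ch dh]|[ch dh]]; split=> //.
  by move=> x Ux; apply: ch; rewrite inE.
by move=> x /[!inE] Ux; apply: ch.
Qed.

Lemma Ck0P U h : Ck U 0 h <-> (forall x, U x -> {for x, continuous h}).
Proof.
split=> [[ch _] x Ux|ch]; first by apply: ch; rewrite inE.
by split=> // x /[!inE] Ux; apply: ch.
Qed.

Lemma Ck_derivable U k h x i : Ck U k.+1 h -> U x -> derivable h x (evec R i).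
Proof. by move=> /CkSP[_ /(_ i)[+ _]]; exact. Qed.

Lemma Ck_pder U k h i : Ck U k.+1 h -> Ck U k (pder i h).
Proof. by move=> /CkSP[_ /(_ i)[]]. Qed.

Lemma CkW U k h : Ck U k.+1 h -> Ck U k h.
Proof.
elim: k h => [|k IH] h /CkSP[ch dh]; first exact/Ck0P.
apply/CkSP; split=> // i; have [? ?] := dh i; split=> //; exact: IH.
Qed.

Lemma Ck_le U k l h : (l <= k)%N -> Ck U k h -> Ck U l h.
Proof.
move=> /subnKC <-; elim: (k - l)%N => [|m IH]; first by rewrite addn0.
by rewrite addnS => /CkW.
Qed.

Lemma Ck_subset U V k h : V `<=` U -> Ck U k h -> Ck V k h.
Proof.
move=> VU; elim: k h => [|k IH] h.
  by move=> /Ck0P ch; apply/Ck0P => x /VU; exact: ch.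
move=> /CkSP[ch dh]; apply/CkSP; split=> [x /VU|i]; first exact: ch.
by have [? ?] := dh i; split=> [x /VU|]; [auto|exact: IH].
Qed.

Lemma near_open U (P : 'rV[R]_n -> Prop) x :
  open U -> (forall y, U y -> P y) -> U x -> \near x, P x.
Proof.
by move=> oU UP Ux; apply: (filterS UP); exact: open_nbhs_nbhs.
Qed.

Lemma eq_pder U h g i : open U -> (forall x, U x -> h x = g x) ->
  forall x, U x -> pder i h x = pder i g x.
Proof.
move=> oU hg x Ux; apply: near_eq_derive; exact: near_open oU hg Ux.
Qed.

Lemma eq_Ck U k h g : open U -> (forall x, U x -> h x = g x) ->
  Ck U k h -> Ck U k g.
Proof.
move=> oU; elim: k h g => [|k IH] h g hg.
  move=> /Ck0P ch; apply/Ck0P => x Ux.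
  rewrite /prop_for /continuous_at -(hg x Ux).
  apply: cvg_trans (ch x Ux); exact: near_eq_cvg (near_open oU hg Ux).
move=> /CkSP[ch dh]; apply/CkSP; split=> [x Ux|i].
  have /Ck0P : Ck U 0 h by exact/Ck0P.
  rewrite /prop_for /continuous_at -(hg x Ux) => _.
  apply: cvg_trans (ch x Ux); exact: near_eq_cvg (near_open oU hg Ux).
have [di ck] := dh i; split=> [x Ux|].
  by apply: near_eq_derivable (di x Ux); exact: near_open oU hg Ux.
by apply: IH ck => x Ux; apply: eq_pder Ux.
Qed.

Lemma pderD h g i x : derivable h x (evec R i) -> derivable g x (evec R i) ->
  pder i (fun y => h y + g y) x = pder i h x + pder i g x.
Proof. by move=> dh dg; rewrite /pder -deriveD. Qed.

Lemma pderM h g i x : derivable h x (evec R i) -> derivable g x (evec R i) ->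
  pder i (fun y => h y * g y) x = pder i h x * g x + h x * pder i g x.
Proof.
move=> dh dg; rewrite /pder (deriveM dh dg) addrC.
by congr (_ + _); exact: mulrC.
Qed.

Lemma pder_cst (c : R) i : pder i (fun=> c) = fun=> 0.
Proof. by apply/funext => x; exact: derive_cst. Qed.

Lemma pderV h i x : h x != 0 -> derivable h x (evec R i) ->
  pder i (fun y => (h y)^-1) x = - ((h x)^-1 * (h x)^-1 * pder i h x).
Proof.
by move=> h0 dh; rewrite /pder deriveV // expr2 invfM scaleNr.
Qed.

Lemma Ck_cst U k (c : R) : Ck U k (fun=> c).
Proof.
elim: k c => [|k IH] c; first by apply/Ck0P => x _; exact: cst_continuous.
apply/CkSP; split=> [x _|i]; first exact: cst_continuous.
by split=> [x _|]; [exact: derivable_cst|rewrite pder_cst].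
Qed.

Lemma CkD U k h g : open U -> Ck U k h -> Ck U k g -> Ck U k (fun x => h x + g x).
Proof.
move=> oU; elim: k h g => [|k IH] h g.
  move=> /Ck0P ch /Ck0P cg; apply/Ck0P => x Ux.
  exact: (cvgD (ch x Ux) (cg x Ux)).
move=> /CkSP[ch dh] /CkSP[cg dg]; apply/CkSP; split=> [x Ux|i].
  exact: (cvgD (ch x Ux) (cg x Ux)).
have [dhi chi] := dh i; have [dgi cgi] := dg i; split=> [x Ux|].
  by apply: derivableD; [exact: dhi|exact: dgi].
apply: eq_Ck (IH _ _ chi cgi) => // x Ux.
by rewrite pderD; [|exact: dhi|exact: dgi].
Qed.

Lemma CkM U k h g : open U -> Ck U k h -> Ck U k g -> Ck U k (fun x => h x * g x).
Proof.
move=> oU; elim: k h g => [|k IH] h g hk gk.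
  move: hk gk => /Ck0P ch /Ck0P cg; apply/Ck0P => x Ux.
  exact: (cvgM (ch x Ux) (cg x Ux)).
move: (hk) (gk) => /CkSP[ch dh] /CkSP[cg dg]; apply/CkSP; split=> [x Ux|i].
  exact: (cvgM (ch x Ux) (cg x Ux)).
have [dhi chi] := dh i; have [dgi cgi] := dg i; split=> [x Ux|].
  by apply: derivableM; [exact: dhi|exact: dgi].
apply: (@eq_Ck _ _ (fun x => pder i h x * g x + h x * pder i g x)) => //.
  by move=> x Ux; rewrite pderM; [|exact: dhi|exact: dgi].
by apply: CkD => //; apply: IH => //; exact: CkW.
Qed.

Lemma CkN U k h : open U -> Ck U k h -> Ck U k (fun x => - h x).
Proof.
move=> oU hk; apply: (@eq_Ck _ _ (fun x => -1 * h x)) => //.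
  by move=> x _; rewrite mulN1r.
by apply: CkM => //; exact: Ck_cst.
Qed.

Lemma CkB U k h g : open U -> Ck U k h -> Ck U k g -> Ck U k (fun x => h x - g x).
Proof. by move=> oU hk gk; apply: CkD => //; exact: CkN. Qed.

Lemma CkV U k h : open U -> (forall x, U x -> h x != 0) -> Ck U k h ->
  Ck U k (fun x => (h x)^-1).
Proof.
move=> oU h0; elim: k => [|k IH] hk.
  move: hk => /Ck0P ch; apply/Ck0P => x Ux.
  exact: (cvgV (h0 x Ux) (ch x Ux)).
move: (hk) => /CkSP[ch dh]; apply/CkSP; split=> [x Ux|i].
  exact: (cvgV (h0 x Ux) (ch x Ux)).
have [dhi chi] := dh i; split=> [x Ux|].
  by apply: derivableV; [exact: h0|exact: dhi].
apply: (@eq_Ck _ _ (fun x => - ((h x)^-1 * (h x)^-1 * pder i h x))) => //.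
  by move=> x Ux; rewrite pderV; [|exact: h0|exact: dhi].
by apply/CkN => //; apply: CkM => //; apply: CkM => //; apply: IH; exact: CkW.
Qed.

Lemma Ck_sum U k (I : Type) (r : seq I) (P : pred I) (F : I -> 'rV[R]_n -> R) :
  open U -> (forall a, Ck U k (F a)) -> Ck U k (fun x => \sum_(a <- r | P a) F a x).
Proof.
move=> oU Fk; elim: r => [|a r IH].
  by under eq_fun do rewrite big_nil; exact: Ck_cst.
under eq_fun do rewrite big_cons.
by case: (P a) => //; exact: CkD.
Qed.

Lemma Ck_prod U k (I : Type) (r : seq I) (P : pred I) (F : I -> 'rV[R]_n -> R) :
  open U -> (forall a, Ck U k (F a)) -> Ck U k (fun x => \prod_(a <- r | P a) F a x).
Proof.
move=> oU Fk; elim: r => [|a r IH].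
  by under eq_fun do rewrite big_nil; exact: Ck_cst.
under eq_fun do rewrite big_cons.
by case: (P a) => //; exact: CkM.
Qed.

Lemma pder_sum (I : Type) (r : seq I) (P : pred I) (F : I -> 'rV[R]_n -> R) i x :
  (forall a, derivable (F a) x (evec R i)) ->
  derivable (fun x => \sum_(a <- r | P a) F a x) x (evec R i) /\
  pder i (fun x => \sum_(a <- r | P a) F a x) x = \sum_(a <- r | P a) pder i (F a) x.
Proof.
move=> dF; elim: r => [|a r [IH1 IH2]].
  under eq_fun do rewrite big_nil.
  by rewrite big_nil pder_cst; split=> //; exact: derivable_cst.
under eq_fun do rewrite big_cons; rewrite big_cons.
case: (P a); last by split; [exact: IH1|exact: IH2].
split; first exact: derivableD (dF a) IH1.
by rewrite (pderD (dF a) IH1) IH2.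
Qed.

(* A record, so that unification never unfolds the quantification over entries. *)
Record mxCk p q U k (A : 'rV[R]_n -> 'M[R]_(p, q)) : Prop := MxCk {
  mxCk_entry : forall a b, Ck U k (fun x => A x a b)
}.

Lemma Ck_det p U k (A : 'rV[R]_n -> 'M[R]_p) : open U -> mxCk U k A ->
  Ck U k (fun x => \det (A x)).
Proof.
move=> oU [Ak]; apply: Ck_sum => // s.
by apply: CkM; [|exact: Ck_cst|exact: Ck_prod].
Qed.

(** By Cramer's rule the entries of the inverse are polynomials in the entries of [A] divided by a
    determinant that does not vanish on [U]. *)
Lemma mxCk_invmx p U k (A : 'rV[R]_n -> 'M[R]_p) : open U -> mxCk U k A ->
  (forall x, U x -> A x \in unitmx) -> mxCk U k (fun x => invmx (A x)).
Proof.
move=> oU Ak Au; split=> a b.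
apply: (@eq_Ck _ _ (fun x => (\det (A x))^-1 * \adj (A x) a b)) => //.
  by move=> x Ux; rewrite /invmx (Au x Ux) !mxE.
apply: CkM => //; first by apply: CkV => //; [move=> x /Au; rewrite unitmxE unitfE|exact: Ck_det].
under eq_fun do rewrite mxE; apply: CkM => //; first exact: Ck_cst.
apply: Ck_det => //; split=> c d; under eq_fun do rewrite !mxE.
exact (mxCk_entry Ak _ _).
Qed.

End Ck.

(** * The mean value theorem and symmetry of second derivatives *)

(** A directional derivative sees only the values along one line, so equal values along two lines
    give equal difference quotients. No differentiability is assumed; this serves both restriction
    to a line and composition with a linear map. *)
Lemma eq_growth_derive (R : numFieldType) (V V' W : normedModType R)
    (f : V -> W) (g : V' -> W) a v b w :
  (forall u : R, f (u *: v + a) = g (u *: w + b)) ->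
  (derivable f a v = derivable g b w) * ('D_v f a = 'D_w g b).
Proof.
move=> fg.
have E : (fun u => u^-1 *: ((f \o shift a) (u *: v) - f a)) =
         (fun u => u^-1 *: ((g \o shift b) (u *: w) - g b)).
  apply/funext => u /=; rewrite fg; congr (_ *: (_ - _)).
  by have := fg 0; rewrite !scale0r !add0r.
by rewrite /derivable /derive E.
Qed.

Section Differentiation.
Variables (R : realType) (n : nat).
Implicit Types (U : set 'rV[R]_n) (h : 'rV[R]_n -> R) (i j : 'I_n) (k : nat).

Lemma ler_rV_norm (v : 'rV[R]_n) j : `|v 0 j| <= `|v|.
Proof.
rewrite [leRHS]/Num.Def.normr/= mx_normrE.
exact: (@le_bigmax _ _ _ _ (fun ij : 'I_1 * 'I_n => `|v ij.1 ij.2|) (0, j)).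
Qed.

Lemma rV_norm_le (v : 'rV[R]_n) c :
  0 <= c -> (forall j, `|v 0 j| <= c) -> `|v| <= c.
Proof.
move=> c0 vc; rewrite /Num.Def.normr/= mx_normrE.
by apply: bigmax_le => //= -[i j] _ /=; rewrite ord1.
Qed.

Lemma norm_evec i : `|evec R i| <= 1.
Proof.
apply: rV_norm_le => // j; rewrite /evec mxE eqxx /=.
by case: (j == i); rewrite ?normr1 ?normr0.
Qed.

(** The bound on [|c|] stands for [c] lying between 0 and [s]; in this form the sign of [s] never
    has to be tracked. *)
Lemma mean_value (f df : R -> R) (s : R) :
  (forall t : R, `|t| <= `|s| -> is_derive t (1 : R) f (df t)) ->
  exists2 c, `|c| <= `|s| & f s - f 0 = s * df c.
Proof.
move=> fd.
have cf a b : `|a| <= `|s| -> `|b| <= `|s| -> {within `[a, b], continuous f}.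
  move=> sa sb; apply: derivable_within_continuous => t.
  rewrite in_itv /= => /andP[at_ tb].
  by apply: (@ex_derive _ _ _ _ _ _ _ (fd _ _)); move: sa sb; rewrite !ler_norml; lra.
have [s0|/ltW s0] := leP 0 s.
  have /(_ _ _)[||c] := @MVT_segment _ f df 0 s s0.
  - by move=> t; rewrite in_itv /= => /andP[t0 ts]; apply: fd; rewrite !ger0_norm // ltW.
  - by apply: cf; rewrite ?normr0.
   rewrite in_itv /= => /andP[c0 cs] E; exists c.
    by rewrite !ger0_norm.
  by rewrite E subr0 mulrC.
have /(_ _ _)[||c] := @MVT_segment _ f df s 0 s0.
- by move=> t; rewrite in_itv /= => /andP[t0 ts]; apply: fd; rewrite !ler0_norm ?lerN2 // ltW.
- by apply: cf; rewrite ?normr0.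
 rewrite in_itv /= => /andP[c0 cs] E; exists c.
  by rewrite !ler0_norm // lerN2.
by apply: oppr_inj; rewrite opprB E; ring.
Qed.

Lemma is_derive_line h (z v : 'rV[R]_n) (t : R) : derivable h (z + t *: v) v ->
  is_derive t (1 : R) (fun t => h (z + t *: v)) ('D_v h (z + t *: v)).
Proof.
move=> dh.
have [E1 E2] := @eq_growth_derive R _ _ _ (fun t : R => h (z + t *: v)) h t 1
  (z + t *: v) v (fun u => congr1 h (etrans (congr1 (fun s => z + s *: v)
     (congr1 (+%R^~ t) (mulr1 u))) (etrans (congr1 (+%R z) (scalerDl v u t)) (addrCA _ _ _)))).
by split; [rewrite E1|exact: E2].
Qed.

Lemma increment_line h (z : 'rV[R]_n) i (s : R) :
  (forall t, `|t| <= `|s| -> derivable h (z + t *: evec R i) (evec R i)) ->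
  exists2 c, `|c| <= `|s| &
    h (z + s *: evec R i) - h z = s * pder i h (z + c *: evec R i).
Proof.
move=> dh; have [t ts|c cs E] := @mean_value (fun t => h (z + t *: evec R i))
  (fun t => pder i h (z + t *: evec R i)) s.
  exact/is_derive_line/dh.
by exists c => //; rewrite -E scale0r addr0.
Qed.

Lemma norm_shift2 x i j (a b : R) :
  `|x + a *: evec R i + b *: evec R j - x| <= `|a| + `|b|.
Proof.
rewrite -[x + _ + _]addrA [x + _ - x]addrAC subrr add0r (le_trans (ler_normD _ _)) // !normrZ.
by apply: lerD; rewrite ler_piMr // norm_evec.
Qed.

(** Two applications of the mean value theorem: in direction [i] to the increment of [h] in
    direction [j], then in direction [j] to [pder i h]. The left side is symmetric in [i] and [j],
    which is what makes the mixed derivatives comparable. *)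
Lemma second_difference U h i j x (d s : R) : Ck U 2%N h ->
  (forall y, `|y - x| < d -> U y) -> 0 < s -> s + s < d ->
  exists2 y, `|y - x| <= s + s &
    h (x + s *: evec R i + s *: evec R j) - h (x + s *: evec R i) -
    (h (x + s *: evec R j) - h x) = s * s * pder j (pder i h) y.
Proof.
move=> h2 dU s0 sd.
have inU a b : `|a| <= s -> `|b| <= s -> U (x + a *: evec R i + b *: evec R j).
  move=> sa sb; apply: dU; apply: le_lt_trans sd.
  by apply: le_trans (norm_shift2 _ _ _ _ _) _; exact: lerD.
have s0n : `|s| = s by rewrite gtr0_norm.
have [|c cs E] := @mean_value
   (fun t => h (x + s *: evec R j + t *: evec R i) - h (x + t *: evec R i))
   (fun t => pder i h (x + s *: evec R j + t *: evec R i)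
     - pder i h (x + t *: evec R i)) s.
  move=> t; rewrite s0n => ts; apply: is_deriveB.
    apply: is_derive_line; apply: (Ck_derivable h2).
    by rewrite addrAC; apply: inU; rewrite ?s0n.
  apply: is_derive_line; apply: (Ck_derivable h2).
  by rewrite -[X in U X]addr0 -[X in _ + X](scale0r (evec R j)); apply: inU; rewrite ?normr0 // ltW.
rewrite s0n in cs.
have [t|c' cs' E'] := @increment_line (pder i h) (x + c *: evec R i) j s.
  by rewrite s0n => ts; apply: (Ck_derivable (Ck_pder i h2)); exact: inU.
rewrite s0n in cs'.
exists (x + c *: evec R i + c' *: evec R j).
  by apply: le_trans (norm_shift2 _ _ _ _ _) _; exact: lerD.
move: E; rewrite !scale0r !addr0 [x + s *: evec R j + c *: _]addrAC E' mulrA => <-.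
by rewrite [x + s *: evec R j + _]addrAC; ring.
Qed.

Lemma open_normP U x : open U -> U x ->
  exists2 d : R, 0 < d & forall y, `|y - x| < d -> U y.
Proof.
move=> oU Ux; have /nbhs_ballP[d /= d0 dU] := open_nbhs_nbhs (conj oU Ux).
exists d => // y yx; apply: dU; rewrite mx_norm_ball /ball_ /=.
by rewrite distrC.
Qed.

Lemma Ck_normP U k h x (e : R) : Ck U k h -> U x -> 0 < e ->
  exists2 d : R, 0 < d & forall y, `|y - x| < d -> `|h y - h x| < e.
Proof.
move=> hk Ux e0; have /cvgrPdist_lt/(_ e e0)/nbhs_ballP[d /= d0 dh] := Ck_continuous hk Ux.
exists d => // y yx; rewrite distrC; apply: dh; rewrite mx_norm_ball /ball_ /=.
by rewrite distrC.
Qed.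

Lemma pder_sym U h i j x : open U -> Ck U 2%N h -> U x ->
  pder i (pder j h) x = pder j (pder i h) x.
Proof.
(* If the mixed derivatives differ by [e] at [x], then by continuity each stays within [e / 2] of
   its value at [x] on a small ball. *)
move=> oU h2 Ux; apply/eqP; rewrite -subr_eq0 -normr_le0 leNgt; apply/negP => e0.
set e := `|_| in e0.
have [d0 d0_gt0 dU] := open_normP oU Ux.
have e2 : 0 < e / 2 by rewrite divr_gt0.
have [d1 d1_gt0 dij] := Ck_normP (Ck_pder i (Ck_pder j h2)) Ux e2.
have [d2 d2_gt0 dji] := Ck_normP (Ck_pder j (Ck_pder i h2)) Ux e2.
pose d := Num.min d0 (Num.min d1 d2).
have d_gt0 : 0 < d by rewrite !lt_min d0_gt0 d1_gt0 d2_gt0.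
(* With step [d / 3] the intermediate points lie within [2 d / 3] of [x], hence inside the ball of
   radius [d]. *)
have s0 : 0 < d / 3 by rewrite divr_gt0.
have sd : d / 3 + d / 3 < d by lra.
have dd y : `|y - x| <= d / 3 + d / 3 -> [/\ `|y - x| < d0, `|y - x| < d1 & `|y - x| < d2].
  by move=> /le_lt_trans/(_ sd); rewrite !lt_min => /and3P[].
have dU' y : `|y - x| < d -> U y by rewrite lt_min => /andP[/dU].
have [y yx Ey] := second_difference i j h2 dU' s0 sd.
have [z zx Ez] := second_difference j i h2 dU' s0 sd.
(* Both sides, multiplied by the squared step, equal the same second difference. *)
have E : pder j (pder i h) y = pder i (pder j h) z.
  have ss : d / 3 * (d / 3) != 0 by rewrite mulf_neq0 ?gt_eqF.
  apply: (mulfI ss); apply: etrans (esym Ey) (etrans _ Ez).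
  have alg (a b c c' : R) : a - b - (c - c') = a - c - (b - c') by ring.
  by rewrite (addrAC x); exact: alg.
have [_ _ /dji] := dd y yx; have [_ /dij] := dd z zx.
rewrite E => B _ A.
have close (a b c : R) : `|c - a| < `|a - b| / 2 -> `|c - b| < `|a - b| / 2 -> False.
  move=> ca cb; have := le_lt_trans (ler_distD c a b) (ltrD _ cb).
  by rewrite distrC => /(_ _ ca); rewrite -splitr ltxx.
exact: (close _ _ _ B A).
Qed.

End Differentiation.

(** * The chain rule *)

Section ChainRule.
Variables (R : realType) (n : nat).
Implicit Types (U : set 'rV[R]_n) (h : 'rV[R]_n -> R) (b w : 'rV[R]_n) (k : 'I_n).

(** The points [b + trunc m w] lead from [b] to [b + w] by changing one coordinate at a time, so
    each leg is a one-variable problem. In the max norm no leg goes farther from [b] than [|w|]. *)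
Definition trunc (m : nat) w : 'rV[R]_n := \row_j (if (j < m)%N then w 0 j else 0).

Lemma trunc0 w : trunc 0 w = 0.
Proof. by apply/rowP => j; rewrite !mxE ltn0. Qed.

Lemma trunc_full w : trunc n w = w.
Proof. by apply/rowP => j; rewrite !mxE ltn_ord. Qed.

Lemma truncS k w : trunc k.+1 w = trunc k w + w 0 k *: evec R k.
Proof.
apply/rowP => j; rewrite !mxE eqxx /= ltnS leq_eqVlt.
have [->|jk] := eqVneq j k; first by rewrite eqxx ltnn /= add0r mulr1.
by rewrite -val_eqE /= in jk; rewrite (negPf jk) /= mulr0 addr0.
Qed.

Lemma trunc_increment h b w k :
  (forall y, `|y - b| <= `|w| -> derivable h y (evec R k)) ->
  exists2 y, `|y - b| <= `|w| &
    h (b + trunc k.+1 w) - h (b + trunc k w) = w 0 k * pder k h y.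
Proof.
move=> dh.
have le_w (t : R) : `|t| <= `|w 0 k| -> `|b + trunc k w + t *: evec R k - b| <= `|w|.
  move=> tw; rewrite -[b + _ + _]addrA [b + _ - b]addrAC subrr add0r.
  apply: rV_norm_le => // j; rewrite !mxE eqxx /=.
  have [->|jk] := eqVneq j k.
    by rewrite ltnn add0r mulr1 (le_trans tw) // ler_rV_norm.
  by rewrite mulr0 addr0; case: ifP => _; rewrite ?normr0 // ler_rV_norm.
have [t /le_w/dh //|c cw E] := @increment_line _ _ h (b + trunc k w) k (w 0 k).
exists (b + trunc k w + c *: evec R k); first exact: le_w.
by rewrite truncS addrA.
Qed.

Lemma trunc_telescope h b w :
  h (b + w) - h b = \sum_(k < n) (h (b + trunc k.+1 w) - h (b + trunc k w)).
Proof.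
rewrite -(big_mkord xpredT (fun k : nat => h (b + trunc k.+1 w) - h (b + trunc k w))).
by rewrite (telescope_sumr (fun k : nat => h (b + trunc k w))) // trunc0 addr0 trunc_full.
Qed.

(** The difference quotient of the [k]-th leg. The value chosen for a leg of length 0 is its limit,
    so that [slopeE] holds without exception and the slope tends to the partial derivative as [w]
    tends to 0. *)
Definition slope h b k w : R :=
  if w 0 k == 0 then pder k h b
  else (h (b + trunc k.+1 w) - h (b + trunc k w)) / w 0 k.

Lemma slopeE h b w : h (b + w) - h b = \sum_(k < n) w 0 k * slope h b k w.
Proof.
rewrite trunc_telescope; apply: eq_bigr => k _; rewrite /slope.
have [w0|w0] := eqVneq (w 0 k) 0; last by rewrite mulrC divfK.
by rewrite truncS w0 scale0r addr0 subrr mul0r.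
Qed.

Lemma slope_cvg U h b k : open U -> Ck U 1%N h -> U b ->
  slope h b k w @[w --> (0 : 'rV[R]_n)] --> pder k h b.
Proof.
move=> oU h1 Ub.
have F0 : Filter (nbhs (0 : 'rV[R]_n)) by exact: nbhs_filter.
apply/(@cvgrPdist_lt _ _ _ _ F0) => e e0.
have [d d0 dU] := open_normP oU Ub.
have [d' d'0 dh] := Ck_normP (Ck_pder k h1) Ub e0.
apply/nbhs_ballP; exists (Num.min d d') => /=; first by rewrite lt_min d0.
move=> w; rewrite mx_norm_ball /ball_ /= sub0r normrN lt_min => /andP[wd wd'].
rewrite /slope; case: ifPn => [_|w0]; first by rewrite subrr normr0.
have [y yb|y yb ->] := @trunc_increment h b w k.
  by apply: (Ck_derivable h1); apply: dU; apply: le_lt_trans wd.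
rewrite mulrAC divff // mul1r distrC; apply: dh.
exact: le_lt_trans wd'.
Qed.

Lemma pder0_locally_constant U h b : open U -> Ck U 1%N h -> U b ->
  (forall k y, U y -> pder k h y = 0) -> \forall y \near b, h y = h b.
Proof.
move=> oU h1 Ub dh0; have [d d0 dU] := open_normP oU Ub.
apply/nbhs_ballP; exists d => //= y; rewrite mx_norm_ball /ball_ /= distrC => yd.
apply/eqP; rewrite -subr_eq0 -[y](subrK b) [y - b + b]addrC trunc_telescope.
rewrite big1 // => k _.
have inU z : `|z - b| <= `|y - b| -> U z by move=> zy; apply: dU; apply: le_lt_trans yd.
have [z /inU/(Ck_derivable h1) //|z /inU zb ->] := @trunc_increment h b (y - b) k.
by rewrite dh0 // mulr0.
Qed.

(** By [slopeE] the difference quotient of the composite is a finite sum of quotients of the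
    components of [y] times slopes of [h], and each factor converges. Derivability of [y] is used in
    the single direction [v] only. *)
Lemma chain_rule m U h (y : 'rV[R]_m -> 'rV[R]_n) x v :
  open U -> Ck U 1%N h -> U (y x) ->
  (forall k, derivable (fun z => y z 0 k) x v) ->
  derivable (fun z => h (y z)) x v /\
  'D_v (fun z => h (y z)) x = \sum_(k < n) 'D_v (fun z => y z 0 k) x * pder k h (y x).
Proof.
move=> oU h1 Uy dy.
have dyv : derivable y x v by apply/derivable_mxP => i j; rewrite ord1; exact: dy.
(* Restricted to the line through [x], [y] is a derivable function of one real variable, hence
   continuous there. *)
have cy : (y (u *: v + x) - y x) @[u --> (0:R)^'] --> (0 : 'rV[R]_n).
  have : {for 0, continuous (fun u : R => y (u *: v + x))}.
    exact/differentiable_continuous/derivable1_diffP/(derivable1P _ _ _).1.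
  move=> /continuous_withinNx; rewrite scale0r add0r => cy.
  by rewrite -(subrr (y x)); apply: cvgB => //; exact: cvg_cst.
have lim : (fun u => u^-1 *: (((fun z => h (y z)) \o shift x) (u *: v) - h (y x))) @ (0:R)^'
   --> \sum_(k < n) 'D_v (fun z => y z 0 k) x * pder k h (y x).
  rewrite (_ : (fun u => _) = fun u => \sum_(k < n)
     (u^-1 *: (((fun z => y z 0 k) \o shift x) (u *: v) - y x 0 k)) *
      slope h (y x) k (y (u *: v + x) - y x)); last first.
    apply/funext => u /=; rewrite -{1}[y (u *: v + x)](subrK (y x)) [_ - _ + _]addrC.
    rewrite slopeE scaler_sumr; apply: eq_bigr => k _.
    by rewrite !mxE /GRing.scale /= mulrA.
  apply: (@cvg_big _ 'I_n +%R 0 xpredT (@add_continuous (R : numFieldType))) => k _; apply: cvgM; first exact: dy.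
  exact: cvg_comp cy (slope_cvg oU h1 Uy).
split; last exact: cvg_lim lim.
by apply/cvg_ex; eexists; exact: lim.
Qed.

End ChainRule.

(** * Matrix-valued calculus *)

Section MatrixAlgebra.
Variables (R : comRingType) (n : nat).
Implicit Types A B : 'M[R]_n.

(** Unlike [mxE], these entry rules leave matrix products folded. *)
Lemma addmxE m p (A B : 'M[R]_(m, p)) i j : (A + B) i j = A i j + B i j.
Proof. by rewrite mxE. Qed.

Lemma oppmxE m p (A : 'M[R]_(m, p)) i j : (- A) i j = - A i j.
Proof. by rewrite mxE. Qed.

Lemma zeromxE m p i j : (0 : 'M[R]_(m, p)) i j = 0.
Proof. by rewrite mxE. Qed.

Lemma trmxD A B : (A + B)^T = A^T + B^T.
Proof. exact: linearD. Qed.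

Lemma trmxN A : (- A)^T = - A^T.
Proof. exact: linearN. Qed.

End MatrixAlgebra.

(** Full distribution and left association give each noncommutative monomial one normal form.
    [mxabel] then treats the monomials as atoms and compares both sides entrywise, where only the
    abelian group structure is left. *)
Ltac mxexpand := rewrite ?(trmxD, trmxN, trmx_mul, trmxK)
  ?(mulmxDl, mulmxDr, mulmxN, mulNmx, mulmxA).
Ltac gen_mul := repeat match goal with |- context [@mulmx ?r ?m ?n ?p ?A ?B] =>
  let P := fresh in move: (@mulmx r m n p A B) => P end.
Ltac gen_ent := repeat match goal with |- context [@fun_of_matrix ?r ?m ?n ?A ?i ?j] =>
  let P := fresh in move: (@fun_of_matrix r m n A i j) => P end.
Ltac mxabel := gen_mul; intros; apply/matrixP => ? ?; rewrite ?(addmxE, oppmxE, zeromxE); gen_ent; ring.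

(** * Curvature identities as matrix algebra, and the double contraction *)

Section MatrixIdentities.
Variables (R : comRingType) (n : nat).
Implicit Types D G W F : 'M[R]_n.

(** Here [D12] stands for d_1 W_2 and [D123] for d_1 d_2 W_3; each of the three groups is the
    derivative of a curvature matrix by the product rule plus its commutator with the connection. *)
Lemma bianchi_identity (W1 W2 W3 D12 D21 D13 D31 D23 D32
    D123 D132 D213 D231 D312 D321 : 'M[R]_n) :
  D123 = D213 -> D132 = D312 -> D231 = D321 ->
  ((D123 - D132 + (D12 *m W3 + W2 *m D13) - (D13 *m W2 + W3 *m D12))
    + W1 *m (D23 - D32 + W2 *m W3 - W3 *m W2) - (D23 - D32 + W2 *m W3 - W3 *m W2) *m W1)
  + ((D231 - D213 + (D23 *m W1 + W3 *m D21) - (D21 *m W3 + W1 *m D23))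
    + W2 *m (D31 - D13 + W3 *m W1 - W1 *m W3) - (D31 - D13 + W3 *m W1 - W1 *m W3) *m W2)
  + ((D312 - D321 + (D31 *m W2 + W1 *m D32) - (D32 *m W1 + W2 *m D31))
    + W3 *m (D12 - D21 + W1 *m W2 - W2 *m W1) - (D12 - D21 + W1 *m W2 - W2 *m W1) *m W3)
  = 0.
Proof. by move=> -> -> ->; mxexpand; mxabel. Qed.

(** The hypothesis is d_1 d_2 G = d_2 d_1 G, both sides expanded by d_i G = W_i^T G + G W_i. Their
    difference is exactly the symmetric part of G F_12. *)
Lemma curvature_skew G W1 W2 D12 D21 :
  D12^T *m G + W2^T *m (W1^T *m G + G *m W1) + ((W1^T *m G + G *m W1) *m W2 + G *m D12) =
  D21^T *m G + W1^T *m (W2^T *m G + G *m W2) + ((W2^T *m G + G *m W2) *m W1 + G *m D21) ->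
  G *m (D12 - D21 + W1 *m W2 - W2 *m W1) + (D12 - D21 + W1 *m W2 - W2 *m W1)^T *m G = 0.
Proof. move=> /eqP; rewrite -subr_eq0 => /eqP <-; mxexpand; mxabel. Qed.

(** The second hypothesis is the derivative of the first, with d G already replaced by W^T G + G
    W. *)
Lemma covariant_skew G W F D :
  G *m F + F^T *m G = 0 ->
  (W^T *m G + G *m W) *m F + G *m D + (D^T *m G + F^T *m (W^T *m G + G *m W)) = 0 ->
  G *m (D + W *m F - F *m W) + (D + W *m F - F *m W)^T *m G = 0.
Proof.
move=> skew dskew.
suff -> : G *m (D + W *m F - F *m W) + (D + W *m F - F *m W)^T *m G =
  ((W^T *m G + G *m W) *m F + G *m D + (D^T *m G + F^T *m (W^T *m G + G *m W)))
  - (W^T *m (G *m F + F^T *m G) + (G *m F + F^T *m G) *m W).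
  by rewrite dskew skew mulmx0 mul0mx addr0 subr0.
by mxexpand; mxabel.
Qed.

End MatrixIdentities.

(** [N m i j] models the covariant derivative of F_ij in direction m, and [u m] the derivative of
    mu. Tracing the cyclic identity twice yields n u_m from one term and - u_m from each of the
    other two, whence the factor n - 2. *)
Lemma schur_contraction (R : fieldType) n (G : 'M[R]_n)
    (N : 'I_n -> 'I_n -> 'I_n -> 'M[R]_n) (u : 'I_n -> R) :
  G \in unitmx -> G^T = G ->
  (forall m i j, N m i j = - N m j i) ->
  (forall m i j, N m i j + N i j m + N j m i = 0) ->
  (forall m i j, G *m N m i j + (N m i j)^T *m G = 0) ->
  (forall m j l, \sum_k N m k j k l = u m * G j l) ->
  forall m, (n%:R - 2) * u m = 0.
Proof.
move=> Gu Gs antisym cyclic skew contr m; pose H := invmx G.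
have GH : G *m H = 1%:M by rewrite mulmxV.
have HG : H *m G = 1%:M by rewrite mulVmx.
have NH k i j : N k i j *m H = - (H *m (N k i j)^T).
  apply/eqP; rewrite -addr_eq0 -[N k i j]mul1mx -{1}HG -!mulmxA.
  rewrite mul1mx -[X in _ + H *m X]mulmx1 -GH [_^T *m (_ *m _)]mulmxA.
  by rewrite -mulmxDr mulmxA -mulmxDl skew mul0mx mulmx0.
(* The cyclic identity for [(m, k, j)] traced over [k]; antisymmetry turns the third term into a
   Ricci contraction with the opposite sign. *)
have E j l : u m * G j l + \sum_k N k j m k l - u j * G m l = 0.
  rewrite -!contr -sumrN -!big_split /=; apply: big1 => k _.
  rewrite (antisym j k m) oppmxE opprK -!addmxE.
  by rewrite cyclic mxE.
have : \sum_j \sum_l (u m * G j l + \sum_k N k j m k l - u j * G m l) * H l j = 0.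
  by apply: big1 => j _; apply: big1 => l _; rewrite E mul0r.
under eq_bigr do under eq_bigr do rewrite mulrDl mulrDl.
under eq_bigr do rewrite !big_split /=.
rewrite !big_split /=.
have -> : \sum_i \sum_l u m * G i l * H l i = n%:R * u m.
  transitivity (\sum_(i < n) u m); last first.
    by rewrite sumr_const card_ord mulr_natl.
  apply: eq_bigr => i _; under eq_bigr do rewrite -mulrA.
  rewrite -mulr_sumr; have /matrixP/(_ i i) := GH; rewrite !mxE => ->.
  by rewrite eqxx mulr1.
have -> : \sum_i \sum_l - (u i * G m l) * H l i = - u m.
  transitivity (\sum_(i < n) - (u i * (m == i)%:R)).
    apply: eq_bigr => i _; under eq_bigr do rewrite mulNr -mulrA.
    rewrite sumrN -mulr_sumr; have /matrixP/(_ m i) := GH.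
    by rewrite !mxE => ->.
  rewrite sumrN (bigD1 m) //= eqxx mulr1 big1 ?addr0 // => i im.
  by rewrite eq_sym (negPf im) mulr0.
(* The divergence term: [N k i m] with an index raised by [H] is antisymmetric by [NH], so
   exchanging its two indices turns the divergence into minus a Ricci contraction. *)
have -> : \sum_i \sum_l (\sum_k N k i m k l) * H l i = - u m; last first.
  by move=> <-; ring.
transitivity (\sum_k \sum_i (N k i m *m H) k i).
  under eq_bigr do under eq_bigr do rewrite mulr_suml.
  under eq_bigr do rewrite exchange_big /=.
  rewrite exchange_big; apply: eq_bigr => k _; apply: eq_bigr => i _.
  by rewrite mxE.
transitivity (\sum_k - \sum_l H k l * \sum_i N k i m i l).
  apply: eq_bigr => k _; under eq_bigr do rewrite NH oppmxE mxE.
  rewrite sumrN exchange_big; congr (- _); apply: eq_bigr => l _.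
  by rewrite mulr_sumr; apply: eq_bigr => i _; rewrite mxE.
transitivity (\sum_k - (u k * (k == m)%:R)).
  apply: eq_bigr => k _; congr (- _).
  have /matrixP/(_ k m) := HG; rewrite !mxE => <-; rewrite mulr_sumr.
  by apply: eq_bigr => l _; rewrite contr -[G in LHS]Gs mxE mulrCA.
rewrite sumrN (bigD1 m) //= eqxx mulr1 big1 ?addr0 // => i im.
by rewrite (negPf im) mulr0.
Qed.

(** * Product rule and symmetry of derivatives for matrix-valued functions *)

Section LocalGeometry.
Variables (R : realType) (n : nat) (U : set 'rV[R]_n).
Hypothesis oU : open U.
Implicit Types (i j : 'I_n) (k : nat) (x : 'rV[R]_n).

Definition mxd p q i (A : 'rV[R]_n -> 'M[R]_(p, q)) x : 'M[R]_(p, q) :=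
  \matrix_(a, b) pder i (fun y => A y a b) x.

Lemma mxdE p q i (A : 'rV[R]_n -> 'M[R]_(p, q)) a b :
  (fun x => mxd i A x a b) = pder i (fun x => A x a b).
Proof. by apply/funext => x; rewrite mxE. Qed.

Lemma mxCkD p q k (A B : 'rV[R]_n -> 'M[R]_(p, q)) :
  mxCk U k A -> mxCk U k B -> mxCk U k (fun x => A x + B x).
Proof. by move=> [Ak] [Bk]; split=> a b; under eq_fun do rewrite mxE; exact: CkD. Qed.

Lemma mxCkN p q k (A : 'rV[R]_n -> 'M[R]_(p, q)) :
  mxCk U k A -> mxCk U k (fun x => - A x).
Proof. by move=> [Ak]; split=> a b; under eq_fun do rewrite mxE; exact: CkN. Qed.

Lemma mxCkM p q r k (A : 'rV[R]_n -> 'M[R]_(p, q)) (B : 'rV[R]_n -> 'M[R]_(q, r)) :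
  mxCk U k A -> mxCk U k B -> mxCk U k (fun x => A x *m B x).
Proof.
move=> [Ak] [Bk]; split=> a b; under eq_fun do rewrite mxE.
by apply: Ck_sum => // c; exact: CkM.
Qed.

Lemma mxCk_tr p q k (A : 'rV[R]_n -> 'M[R]_(p, q)) :
  mxCk U k A -> mxCk U k (fun x => (A x)^T).
Proof. by move=> [Ak]; split=> a b; under eq_fun do rewrite mxE; exact: Ak. Qed.

Lemma mxCk_mxd p q k i (A : 'rV[R]_n -> 'M[R]_(p, q)) :
  mxCk U k.+1 A -> mxCk U k (mxd i A).
Proof. by move=> [Ak]; split=> a b; rewrite mxdE; exact: Ck_pder. Qed.

Lemma mxCkW p q k (A : 'rV[R]_n -> 'M[R]_(p, q)) : mxCk U k.+1 A -> mxCk U k A.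
Proof. by move=> [Ak]; split=> a b; exact: CkW. Qed.

Lemma eq_mxd p q i (A B : 'rV[R]_n -> 'M[R]_(p, q)) x :
  (forall y, U y -> A y = B y) -> U x -> mxd i A x = mxd i B x.
Proof.
by move=> AB Ux; apply/matrixP => a b; rewrite !mxE; apply: (eq_pder _ oU) Ux => y /AB ->.
Qed.

Lemma mxdD p q i (A B : 'rV[R]_n -> 'M[R]_(p, q)) x :
  mxCk U 1%N A -> mxCk U 1%N B -> U x ->
  mxd i (fun y => A y + B y) x = mxd i A x + mxd i B x.
Proof.
move=> [A1] [B1] Ux; apply/matrixP => a b; rewrite !mxE; under eq_fun do rewrite mxE.
by apply: pderD; [exact: Ck_derivable (A1 a b) Ux|exact: Ck_derivable (B1 a b) Ux].
Qed.

Lemma mxdN p q i (A : 'rV[R]_n -> 'M[R]_(p, q)) x :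
  mxCk U 1%N A -> U x -> mxd i (fun y => - A y) x = - mxd i A x.
Proof.
move=> [A1] Ux; apply/matrixP => a b; rewrite !mxE; under eq_fun do rewrite mxE.
exact: deriveN (Ck_derivable (A1 a b) Ux).
Qed.

Lemma mxdM p q r i (A : 'rV[R]_n -> 'M[R]_(p, q)) (B : 'rV[R]_n -> 'M[R]_(q, r)) x :
  mxCk U 1%N A -> mxCk U 1%N B -> U x ->
  mxd i (fun y => A y *m B y) x = mxd i A x *m B x + A x *m mxd i B x.
Proof.
move=> [A1] [B1] Ux; apply/matrixP => a b; rewrite !mxE -big_split /=.
under eq_fun do rewrite mxE.
have dAB c : derivable (fun y => A y a c * B y c b) x (evec R i).
  by apply: derivableM; [exact: Ck_derivable (A1 a c) Ux|exact: Ck_derivable (B1 c b) Ux].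
have [_ ->] := pder_sum (index_enum 'I_q) xpredT dAB.
apply: eq_bigr => c _; rewrite !mxE; apply: pderM.
  exact: Ck_derivable (A1 a c) Ux.
exact: Ck_derivable (B1 c b) Ux.
Qed.

Lemma mxd_tr p q i (A : 'rV[R]_n -> 'M[R]_(p, q)) x :
  mxd i (fun y => (A y)^T) x = (mxd i A x)^T.
Proof. by apply/matrixP => a b; rewrite !mxE; under eq_fun do rewrite mxE. Qed.

Lemma mxd_sym p q i j (A : 'rV[R]_n -> 'M[R]_(p, q)) x :
  mxCk U 2%N A -> U x -> mxd i (mxd j A) x = mxd j (mxd i A) x.
Proof.
move=> [A2] Ux; apply/matrixP => a b; rewrite [LHS]mxE [RHS]mxE !mxdE.
exact: pder_sym (A2 a b) Ux.
Qed.

End LocalGeometry.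

(** * Connection, curvature and Schur's lemma in a chart *)

Section LocalCurvature.
Variables (R : realType) (n : nat).
Implicit Types (G : 'rV[R]_n -> 'M[R]_n) (W : 'I_n -> 'rV[R]_n -> 'M[R]_n).
Implicit Types (i j k l m : 'I_n) (x : 'rV[R]_n).

Definition lchr G k i j x : R :=
  2^-1 * \sum_l invmx (G x) k l *
    (pder i (fun y => G y j l) x + pder j (fun y => G y i l) x
     - pder l (fun y => G y i j) x).

Definition conn G i x : 'M[R]_n := \matrix_(k, l) lchr G k i l x.

Definition curv W i j x : 'M[R]_n :=
  mxd i (W j) x - mxd j (W i) x + W i x *m W j x - W j x *m W i x.

Definition lric G x : 'M[R]_n := \matrix_(j, l) \sum_k curv (conn G) k j x k l.

Lemma curvE W i j x : curv W i j x =
  mxd i (W j) x - mxd j (W i) x + W i x *m W j x - W j x *m W i x.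
Proof. by []. Qed.

Lemma mxd_entry p q i (A : 'rV[R]_n -> 'M[R]_(p, q)) x a b :
  mxd i A x a b = pder i (fun y => A y a b) x.
Proof. by rewrite mxE. Qed.

(** Christoffel symbols of the first kind: the connection with its upper index lowered, free of the
    inverse metric. *)
Definition lowered_conn G i x : 'M[R]_n := \matrix_(m, l)
  (2^-1 * (pder i (fun y => G y l m) x + pder l (fun y => G y i m) x
     - pder m (fun y => G y i l) x)).

Lemma connE G i x : conn G i x = invmx (G x) *m lowered_conn G i x.
Proof.
apply/matrixP => k l; rewrite !mxE /lchr mulr_sumr.
by apply: eq_bigr => m _; rewrite !mxE mulrCA.
Qed.

Section Regular.
Variables (U : set 'rV[R]_n) (oU : open U) (G : 'rV[R]_n -> 'M[R]_n).
Hypothesis G3 : mxCk U 3%N G.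
Hypothesis Gsym : forall x, U x -> (G x)^T = G x.
Hypothesis Gunit : forall x, U x -> G x \in unitmx.

Lemma pder_metric_sym i a b x : U x ->
  pder i (fun y => G y a b) x = pder i (fun y => G y b a) x.
Proof. by move=> Ux; apply: (eq_pder _ oU) Ux => y Uy; rewrite -[in LHS]Gsym // mxE. Qed.

Lemma conn_torsion_free i k l x : U x -> conn G i x k l = conn G l x k i.
Proof.
move=> Ux; rewrite !mxE /lchr; congr (_ * _); apply: eq_bigr => m _.
by rewrite [pder i _ x + _]addrC (pder_metric_sym m i l Ux).
Qed.

Lemma mul_metric_conn i x : U x -> G x *m conn G i x = lowered_conn G i x.
Proof. by move=> Ux; rewrite connE mulmxA mulmxV ?mul1mx // Gunit. Qed.

Lemma conn_metric i x : U x ->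
  mxd i G x = (conn G i x)^T *m G x + G x *m conn G i x.
Proof.
move=> Ux; rewrite -[G x in X in X + _]Gsym // -trmx_mul mul_metric_conn //.
apply/matrixP => a b; rewrite !mxE.
rewrite (pder_metric_sym i b a Ux).
move: (pder i _ x) (pder a _ x) (pder b _ x) => p q r.
by field.
Qed.

Lemma Ck_conn i : mxCk U 2%N (conn G i).
Proof.
split=> k l; rewrite (_ : (fun x => conn G i x k l) = lchr G k i l); last first.
  by apply/funext => x; rewrite mxE.
apply: CkM => //; first exact: Ck_cst.
apply: Ck_sum => // m; apply: CkM => //.
  apply: Ck_le (_ : (2 <= 3)%N) _ => //.
  exact: mxCk_entry (mxCk_invmx oU G3 Gunit) _ _.
by apply: CkB => //; [apply: CkD => //|]; apply: Ck_pder; exact: mxCk_entry G3 _ _.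
Qed.

Lemma Ck_curv i j : mxCk U 1%N (curv (conn G) i j).
Proof.
have W1 k : mxCk U 1%N (conn G k) by exact: mxCkW (Ck_conn _).
apply: (mxCkD oU); last by apply: (mxCkN oU); exact: (mxCkM oU).
apply: (mxCkD oU); last exact: (mxCkM oU).
by apply: (mxCkD oU); [|apply: (mxCkN oU)]; apply: mxCk_mxd; exact: Ck_conn.
Qed.

End Regular.
End LocalCurvature.

(** * Second Bianchi identity and Schur's lemma for a torsion-free metric connection; [F] is a
    variable tied to [W] by [FE], so curvature stays an atom until rewritten *)

Section AbstractConnection.
Variables (R : realType) (n : nat) (U : set 'rV[R]_n) (oU : open U).
Variables (G : 'rV[R]_n -> 'M[R]_n) (W : 'I_n -> 'rV[R]_n -> 'M[R]_n).
Variable F : 'I_n -> 'I_n -> 'rV[R]_n -> 'M[R]_n.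
Hypothesis G2 : mxCk U 2%N G.
Hypothesis Gsym : forall x, U x -> (G x)^T = G x.
Hypothesis Gunit : forall x, U x -> G x \in unitmx.
Hypothesis W2 : forall i, mxCk U 2%N (W i).
Hypothesis torsion_free : forall i k l x, U x -> W i x k l = W l x k i.
Hypothesis metric : forall i x, U x ->
  mxd i G x = (W i x)^T *m G x + G x *m W i x.
Hypothesis FE : forall i j x, F i j x =
  mxd i (W j) x - mxd j (W i) x + W i x *m W j x - W j x *m W i x.
Implicit Types (i j k l m : 'I_n) (x : 'rV[R]_n).

Let W1 i : mxCk U 1%N (W i). Proof. exact: mxCkW (W2 i). Qed.
Let G1 : mxCk U 1%N G. Proof. exact: mxCkW G2. Qed.
Let F1 i j : mxCk U 1%N (F i j).
Proof.
rewrite (funext (FE i j)).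
apply: (mxCkD oU); last by apply: (mxCkN oU); exact: (mxCkM oU).
apply: (mxCkD oU); last exact: (mxCkM oU).
by apply: (mxCkD oU); [|apply: (mxCkN oU)]; apply: mxCk_mxd.
Qed.

(** The covariant derivative of the curvature: the commutator acts on the endomorphism indices, the
    sum on the two form indices [i] and [j]. *)
Definition cov_curv m i j x : 'M[R]_n :=
  mxd m (F i j) x + W m x *m F i j x - F i j x *m W m x
  - \sum_a (W m x a i *: F a j x + W m x a j *: F i a x).

Lemma mxd_curv m i j x : U x -> mxd m (F i j) x =
  mxd m (mxd i (W j)) x - mxd m (mxd j (W i)) x
  + (mxd m (W i) x *m W j x + W i x *m mxd m (W j) x)
  - (mxd m (W j) x *m W i x + W j x *m mxd m (W i) x).
Proof.
move=> Ux.
have -> : mxd m (F i j) x = mxd m (fun x => mxd i (W j) x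
  - mxd j (W i) x + W i x *m W j x - W j x *m W i x) x.
  by apply: (eq_mxd oU _) Ux => y _; exact: FE.
have dW1 k l : mxCk U 1%N (mxd k (W l)) by apply: mxCk_mxd; exact: W2.
have WW k l : mxCk U 1%N (fun x => W k x *m W l x) by exact: (mxCkM oU).
rewrite (mxdD _ _ _ Ux); last 2 first.
- apply: (mxCkD oU); last exact: WW.
  by apply: (mxCkD oU); [|apply: (mxCkN oU)].
- by apply: (mxCkN oU).
rewrite (mxdD _ _ _ Ux); last 2 first.
- by apply: (mxCkD oU); [|apply: (mxCkN oU)].
- exact: WW.
rewrite (mxdD _ _ _ Ux); last 2 first.
- exact: dW1.
- by apply: (mxCkN oU).
rewrite (mxdN _ _ Ux); last exact: dW1.
rewrite (mxdN _ _ Ux); last exact: WW.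
by rewrite !(mxdM _ _ _ Ux).
Qed.

Lemma curvC i j x : F j i x = - F i j x.
Proof. by rewrite !FE; mxabel. Qed.

Lemma curv_skew i j x : U x ->
  G x *m F i j x + (F i j x)^T *m G x = 0.
Proof.
move=> Ux; rewrite FE; apply: curvature_skew.
have dd k l : mxd k (mxd l G) x = (mxd k (W l) x)^T *m G x +
   (W l x)^T *m ((W k x)^T *m G x + G x *m W k x) +
   (((W k x)^T *m G x + G x *m W k x) *m W l x + G x *m mxd k (W l) x).
  rewrite (eq_mxd oU _ (fun y Uy => metric l Uy) Ux).
  rewrite (mxdD _ _ _ Ux); last 2 first.
  - by apply: (mxCkM oU) => //; exact: mxCk_tr.
  - exact: (mxCkM oU).
  rewrite !(mxdM _ _ _ Ux) //; last exact: mxCk_tr.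
  by rewrite mxd_tr !metric.
exact: etrans (esym (dd i j)) (etrans (mxd_sym oU i j G2 Ux) (dd j i)).
Qed.

Lemma cov_curvC m i j x : U x ->
  cov_curv m i j x = - cov_curv m j i x.
Proof.
move=> Ux; rewrite /cov_curv.
have -> : mxd m (F j i) x = - mxd m (F i j) x.
  rewrite -(mxdN _ (F1 i j) Ux).
  by apply: (eq_mxd oU _) Ux => y _; exact: curvC.
rewrite (curvC i j) mulmxN mulNmx.
have -> : \sum_a (W m x a j *: F a i x + W m x a i *: F j a x) =
  - \sum_a (W m x a i *: F a j x + W m x a j *: F i a x).
  rewrite -sumrN; apply: eq_bigr => a _.
  by rewrite (curvC i a) (curvC a j) !scalerN addrC opprD.
by move: (\sum_a _) => S; mxabel.
Qed.

Lemma cov_curv_cyclic m i j x : U x ->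
  cov_curv m i j x + cov_curv i j m x + cov_curv j m i x = 0.
Proof.
move=> Ux; rewrite /cov_curv !(mxd_curv _ _ _ Ux).
have B := @bianchi_identity R n (W m x) (W i x) (W j x)
  (mxd m (W i) x) (mxd i (W m) x) (mxd m (W j) x) (mxd j (W m) x)
  (mxd i (W j) x) (mxd j (W i) x) _ _ _ _ _ _ (mxd_sym oU m i (W2 j) Ux)
  (mxd_sym oU m j (W2 i) Ux) (mxd_sym oU i j (W2 m) Ux).
(* The corrections in the form indices cancel in pairs over the cyclic sum, by torsion freeness and
   antisymmetry of [F]. *)
have S : \sum_a (W m x a i *: F a j x + W m x a j *: F i a x)
  + \sum_a (W i x a j *: F a m x + W i x a m *: F j a x)
  + \sum_a (W j x a m *: F a i x + W j x a i *: F m a x) = 0.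
  rewrite -!big_split /=; apply: big1 => a _.
  rewrite (torsion_free i a m Ux) (torsion_free j a m Ux) (torsion_free j a i Ux).
  rewrite (curvC a j) (curvC a i) (curvC a m) !scalerN.
  by mxabel.
have combine (A1 A2 A3 S1 S2 S3 : 'M[R]_n) : A1 + A2 + A3 = 0 ->
    S1 + S2 + S3 = 0 -> (A1 - S1) + (A2 - S2) + (A3 - S3) = 0.
  by move=> A0 S0; rewrite [X in X + _]addrACA [LHS]addrACA A0 add0r -!opprD S0 oppr0.
rewrite !FE; exact: combine B S.
Qed.

Lemma cov_curv_skew m i j x : U x ->
  G x *m cov_curv m i j x + (cov_curv m i j x)^T *m G x = 0.
Proof.
move=> Ux.
have skewD (A B : 'M[R]_n) : G x *m A + A^T *m G x = 0 ->
    G x *m B + B^T *m G x = 0 -> G x *m (A + B) + (A + B)^T *m G x = 0.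
  by move=> A0 B0; rewrite trmxD mulmxDr mulmxDl addrACA A0 B0 addr0.
have skewZ (c : R) (A : 'M[R]_n) : G x *m A + A^T *m G x = 0 ->
    G x *m (c *: A) + (c *: A)^T *m G x = 0.
  have -> : (c *: A)^T = c *: A^T by exact: linearZ.
  by move=> A0; rewrite -scalemxAr -scalemxAl -scalerDr A0 scaler0.
(* The commutator part comes from differentiating [curv_skew]; the remaining sum is a linear
   combination of skew curvature matrices. *)
apply: (skewD).
  apply: covariant_skew; first exact: curv_skew.
  rewrite -metric //.
  have FT1 := mxCk_tr (F1 i j).
  rewrite -mxd_tr -(mxdM _ G1 (F1 i j) Ux) -(mxdM _ FT1 G1 Ux).
  rewrite -(mxdD _ (mxCkM oU G1 (F1 i j)) (mxCkM oU FT1 G1) Ux).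
  rewrite (eq_mxd oU _ (fun y Uy => curv_skew i j Uy) Ux).
  apply/matrixP => a b; rewrite mxd_entry [RHS]mxE.
  by rewrite (_ : (fun y => _) = fun=> 0) ?pder_cst //; apply/funext => y; rewrite mxE.
rewrite -scaleN1r; apply: (skewZ).
elim/big_ind : _ => [||a _]; first by rewrite trmx0 mulmx0 mul0mx addr0.
  exact: (skewD).
by apply: (skewD); apply: (skewZ); exact: curv_skew.
Qed.

(** Covariant differentiation commutes with the trace and annihilates [G], so applied to Ric = mu G
    it differentiates mu only. *)
Lemma cov_curv_contraction (mu : 'rV[R]_n -> R) m j l x :
  Ck U 1%N mu -> (forall y, U y -> (\matrix_(j, l) \sum_k F k j y k l) = mu y *: G y) -> U x ->
  \sum_k cov_curv m k j x k l = pder m mu x * G x j l.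
Proof.
move=> mu1 einst Ux.
have ric a b : \sum_k F k a x k b = mu x * G x a b.
  by have /matrixP/(_ a b) := einst x Ux; rewrite !mxE.
have dric : \sum_k mxd m (F k j) x k l =
    pder m mu x * G x j l + mu x * mxd m G x j l.
  have dF k : derivable (fun y => F k j y k l) x (evec R m).
    exact: Ck_derivable (mxCk_entry (F1 k j) k l) Ux.
  under eq_bigr do rewrite mxd_entry.
  rewrite -(pder_sum (index_enum 'I_n) xpredT dF).2.
  rewrite (@eq_pder _ _ U _ (fun y => mu y * G y j l)) //; last first.
    by move=> y Uy; have /matrixP/(_ j l) := einst y Uy; rewrite !mxE.
  rewrite pderM ?mxd_entry //; first exact: Ck_derivable mu1 Ux.
  exact: Ck_derivable (mxCk_entry G1 j l) Ux.
(* The corrections in the two traced indices are equal and enter with opposite signs; [c2] and [c3]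
   will cancel mu times the derivative of [G] by [metric]. *)
have c1 : \sum_k (W m x *m F k j x) k l =
    \sum_k (\sum_a W m x a k *: F a j x) k l.
  under eq_bigr do rewrite mxE.
  rewrite exchange_big; apply: eq_bigr => k _; rewrite summxE.
  by apply: eq_bigr => a _; rewrite [RHS]mxE.
have c2 : \sum_k (F k j x *m W m x) k l = mu x * (G x *m W m x) j l.
  under eq_bigr do rewrite mxE.
  rewrite exchange_big mxE mulr_sumr; apply: eq_bigr => a _.
  by rewrite -mulr_suml ric mulrA.
have c3 : \sum_k (\sum_a W m x a j *: F k a x) k l =
    mu x * ((W m x)^T *m G x) j l.
  transitivity (\sum_k \sum_a (W m x a j *: F k a x) k l).
    by apply: eq_bigr => k _; rewrite summxE.
  rewrite exchange_big [X in mu x * X]mxE mulr_sumr; apply: eq_bigr => a _.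
  transitivity (\sum_k W m x a j * F k a x k l).
    by apply: eq_bigr => k _; rewrite [LHS]mxE.
  by rewrite -mulr_sumr ric [_^T _ _]mxE mulrCA.
rewrite /cov_curv; under eq_bigr do rewrite big_split /= !(addmxE, oppmxE).
rewrite !big_split /= !sumrN big_split /= dric c1 c2 c3 metric // addmxE.
move: (\sum_(i < n) _) (pder _ _ _) (_ j l) (_ j l) (_ j l) => p q r s t; ring.
Qed.

Lemma schur_local (mu : 'rV[R]_n -> R) m x : (3 <= n)%N ->
  Ck U 1%N mu -> (forall y, U y -> (\matrix_(j, l) \sum_k F k j y k l) = mu y *: G y) -> U x ->
  pder m mu x = 0.
Proof.
move=> n3 mu1 einst Ux.
have := @schur_contraction R n (G x) (fun m i j => cov_curv m i j x)
  (fun m => pder m mu x) (Gunit Ux) (Gsym Ux) (fun m i j => cov_curvC m i j Ux)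
  (fun m i j => cov_curv_cyclic m i j Ux) (fun m i j => cov_curv_skew m i j Ux)
  (fun m j l => cov_curv_contraction m j l mu1 einst Ux) m.
move/eqP; rewrite mulf_eq0 => /orP[|/eqP //].
by rewrite subr_eq0 eqr_nat => /eqP n2; rewrite n2 in n3.
Qed.

End AbstractConnection.

(** * Change of coordinates *)

(** Koszul's argument: [M i] is symmetric in its lower indices, and three permuted derivatives of
    [G] can be solved for it. *)
Lemma conn_unique (R : realType) n (G : 'rV[R]_n -> 'M[R]_n) (L : 'I_n -> 'M[R]_n) x :
  (G x)^T = G x -> G x \in unitmx ->
  (forall i k l, L i k l = L l k i) ->
  (forall i, mxd i G x = (L i)^T *m G x + G x *m L i) ->
  forall i, conn G i x = L i.
Proof.
move=> Gs Gu Ltf Lm i; pose M i := G x *m L i.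
have MC k a l : M k a l = M l a k.
  by rewrite !mxE; apply: eq_bigr => c _; rewrite Ltf.
have dG k a b : pder k (fun y => G y a b) x = M k b a + M k a b.
  by rewrite -mxd_entry Lm addmxE -{1}Gs -trmx_mul mxE.
rewrite connE (_ : lowered_conn G i x = M i) ?mulKmx //.
apply/matrixP => m l; rewrite mxE !dG (MC i l m) (MC l i m) (MC l m i).
by move: (M i m l) (M m l i) (M m i l) => p q r; field.
Qed.

Section GaugeAlgebra.
Variables (R : comRingType) (n : nat).

(* Differentiating K W_i = d_i K + V_i K gives K F_ij = Fhat_ij K with Fhat the curvature of V. *)
Lemma gauge_curvature (K W1 W2 V1 V2 D1K D2K D12 D21 E12 E21 DD : 'M[R]_n) :
  D1K = K *m W1 - V1 *m K -> D2K = K *m W2 - V2 *m K ->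
  D1K *m W2 + K *m D12 = DD + (E12 *m K + V2 *m D1K) ->
  D2K *m W1 + K *m D21 = DD + (E21 *m K + V1 *m D2K) ->
  K *m (D12 - D21 + W1 *m W2 - W2 *m W1) = (E12 - E21 + V1 *m V2 - V2 *m V1) *m K.
Proof.
move=> d1 d2 e12 e21.
have -> : K *m (D12 - D21 + W1 *m W2 - W2 *m W1) =
  (D1K *m W2 + K *m D12) - (D2K *m W1 + K *m D21)
  - D1K *m W2 + D2K *m W1 + K *m W1 *m W2 - K *m W2 *m W1 by mxexpand; mxabel.
by rewrite e12 e21 d1 d2; mxexpand; mxabel.
Qed.

(** The left side is the product rule for the derivative of [K^T Gt K], so the gauge transform [L]
    of [V] is compatible with the pulled-back metric. *)
Lemma transform_metric (K Gt V L D : 'M[R]_n) : K *m L = D + V *m K ->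
  (D^T *m Gt + K^T *m (V^T *m Gt + Gt *m V)) *m K + K^T *m Gt *m D =
  L^T *m (K^T *m Gt *m K) + K^T *m Gt *m K *m L.
Proof.
move=> KL; have -> : L^T *m (K^T *m Gt *m K) = (K *m L)^T *m Gt *m K.
  by mxexpand.
have -> : K^T *m Gt *m K *m L = K^T *m Gt *m (K *m L) by mxexpand.
by rewrite KL; mxexpand; mxabel.
Qed.

End GaugeAlgebra.

(** The upper index carries the inverse of [K] and the form index traced against it carries [K]; the
    two cancel. *)
Lemma contract_gauge (R : fieldType) n (K : 'M[R]_n) (Y : 'I_n -> 'M[R]_n) l :
  K \in unitmx ->
  \sum_k (invmx K *m (\sum_a K a k *: Y a)) k l = \sum_a Y a a l.
Proof.
move=> Ku; transitivity (\sum_k \sum_b \sum_a K a k * invmx K k b * Y a b l).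
  apply: eq_bigr => k _; rewrite mxE; apply: eq_bigr => b _.
  rewrite summxE mulr_sumr; apply: eq_bigr => a _.
  by rewrite [X in _ * X = _]mxE mulrCA mulrA.
rewrite exchange_big /= [LHS](eq_bigr (fun b => \sum_a (b == a)%:R * Y a b l)).
  rewrite exchange_big; apply: eq_bigr => a _.
  rewrite (bigD1 a) //= eqxx mul1r big1 ?addr0 // => b /negPf ba.
  by rewrite ba mul0r.
move=> b _; rewrite exchange_big; apply: eq_bigr => a _.
rewrite -mulr_suml; congr (_ * _).
by have /matrixP/(_ a b) := mulmxV Ku; rewrite !mxE eq_sym => ->.
Qed.

Section ChangeOfCoordinates.
Variables (R : realType) (n : nat) (V U : set 'rV[R]_n) (oV : open V) (oU : open U).
Variable y : 'rV[R]_n -> 'rV[R]_n.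
Hypothesis y3 : forall a, Ck V 3%N (fun x => y x 0 a).
Hypothesis yVU : forall x, V x -> U (y x).
Implicit Types (i j k l : 'I_n) (x : 'rV[R]_n).

(** The transpose of [jacobian]: it acts on column vectors and so multiplies connection matrices on
    the left. *)
Definition jac x : 'M[R]_n := \matrix_(a, i) pder i (fun z => y z 0 a) x.

Lemma jac_C2 : mxCk V 2%N jac.
Proof.
split=> a i; rewrite (_ : (fun x => jac x a i) = pder i (fun z => y z 0 a)).
  exact: Ck_pder.
by apply/funext => x; rewrite mxE.
Qed.

Lemma mxd_jac_sym i j b x : V x -> mxd i jac x b j = mxd j jac x b i.
Proof.
move=> Vx; rewrite [LHS]mxd_entry [RHS]mxd_entry.
have E k : (fun z => jac z b k) = pder k (fun z => y z 0 b).
  by apply/funext => z; rewrite mxE.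
by rewrite !E; exact: pder_sym (CkW (y3 b)) Vx.
Qed.

Lemma derivable_comp_chart (h : 'rV[R]_n -> R) i x : Ck U 1%N h -> V x ->
  derivable (fun z => h (y z)) x (evec R i) /\
  pder i (fun z => h (y z)) x = \sum_a jac x a i * pder a h (y x).
Proof.
move=> h1 Vx.
have [k|d E] := @chain_rule R n n U h y x (evec R i) oU h1 (yVU Vx).
  exact: Ck_derivable (CkW (CkW (y3 k))) Vx.
split=> //; rewrite /pder E; apply: eq_bigr => a _.
by rewrite mxE.
Qed.

Lemma mxd_comp_chart p q (A : 'rV[R]_n -> 'M[R]_(p, q)) i x : mxCk U 1%N A -> V x ->
  mxd i (fun z => A (y z)) x = \sum_a jac x a i *: mxd a A (y x).
Proof.
move=> A1 Vx; apply/matrixP => a b; rewrite mxd_entry summxE.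
have [_ ->] := derivable_comp_chart i (mxCk_entry A1 a b) Vx.
apply: eq_bigr => c _; rewrite [RHS]mxE; congr (_ * _).
by rewrite [RHS]mxd_entry.
Qed.

Lemma continuous_chart x : V x -> {for x, continuous y}.
Proof.
move=> Vx.
have Fx : Filter (nbhs x) by exact: nbhs_filter.
apply/(@cvgrPdist_lt _ _ _ _ Fx) => e e0.
have e2 : 0 < e / 2 by rewrite divr_gt0.
have : \forall z \near x, forall a, `|y x 0 a - y z 0 a| <= e / 2.
  apply: (@filter_forall _ _ (fun a z => `|y x 0 a - y z 0 a| <= e / 2) _ Fx) => a; have [d d0 dy] := Ck_normP (y3 a) Vx e2.
  apply/nbhs_ballP; exists d => //= z; rewrite mx_norm_ball /ball_ /= distrC => zx.
  by rewrite distrC ltW // dy.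
apply: filterS => z yz; apply: (@le_lt_trans _ _ (e / 2)); last by rewrite ltr_pdivrMr // ltr_pMr // ltr1n.
apply: rV_norm_le; first exact: ltW.
by move=> a; rewrite addmxE oppmxE.
Qed.

Lemma Ck0_comp_chart (h : 'rV[R]_n -> R) : Ck U 0%N h -> Ck V 0%N (fun x => h (y x)).
Proof.
move=> h0; apply/Ck0P => x Vx.
exact: (continuous_comp (continuous_chart Vx) (Ck_continuous h0 (yVU Vx))).
Qed.

Lemma Ck1_comp_chart (h : 'rV[R]_n -> R) : Ck U 1%N h -> Ck V 1%N (fun x => h (y x)).
Proof.
move=> h1; apply/CkSP; split=> [x|i].
  by have /Ck0P := Ck0_comp_chart (CkW h1); exact.
split=> [x Vx|]; first exact: (derivable_comp_chart i h1 Vx).1.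
apply: (@eq_Ck _ _ V 0%N (fun x => \sum_a jac x a i * pder a h (y x))) => //.
  by move=> x Vx; rewrite (derivable_comp_chart i h1 Vx).2.
apply: Ck_sum => // a; apply: CkM => //.
  exact: CkW (CkW (mxCk_entry jac_C2 a i)).
exact: Ck0_comp_chart (Ck_pder a h1).
Qed.

Lemma mxCk1_comp_chart p q (A : 'rV[R]_n -> 'M[R]_(p, q)) :
  mxCk U 1%N A -> mxCk V 1%N (fun x => A (y x)).
Proof. by move=> [A1]; split=> a b; exact: Ck1_comp_chart (A1 a b). Qed.

Section TransformedConnection.
Variables (W W' : 'I_n -> 'rV[R]_n -> 'M[R]_n).

(** The pull-back by [y] of the connection form, acting only on its form index; the endomorphism
    indices stay in the target coordinates. *)
Definition pull_conn i x : 'M[R]_n := \sum_a jac x a i *: W' a (y x).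

Lemma conn_transform (G G' : 'rV[R]_n -> 'M[R]_n) :
  (forall x, V x -> (G x)^T = G x) -> (forall x, V x -> G x \in unitmx) ->
  (forall x, V x -> G x = (jac x)^T *m G' (y x) *m jac x) ->
  (forall x, V x -> jac x \in unitmx) ->
  mxCk U 1%N G' ->
  (forall i k l x, U x -> W' i x k l = W' l x k i) ->
  (forall i x, U x -> mxd i G' x = (W' i x)^T *m G' x + G' x *m W' i x) ->
  forall i x, V x -> jac x *m conn G i x = mxd i jac x + pull_conn i x *m jac x.
Proof.
move=> Gs Gu Gjac Ku G'1 tf met i x Vx; have K1 := mxCkW jac_C2.
(* The gauge formula solved for the connection. [L] is torsion-free because second derivatives of
   [y] are symmetric and [W'] is torsion-free, and metric by [transform_metric]; uniqueness
   identifies it. *)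
pose L i := invmx (jac x) *m (mxd i jac x + pull_conn i x *m jac x).
have KL k : jac x *m L k = mxd k jac x + pull_conn k x *m jac x.
  by rewrite mulmxA mulmxV ?mul1mx // Ku.
rewrite (@conn_unique R n G L x (Gs x Vx) (Gu x Vx)) //.
  move=> k a l; rewrite [LHS]mxE [RHS]mxE; apply: eq_bigr => b _; congr (_ * _).
  rewrite [LHS]addmxE [RHS]addmxE; congr (_ + _); first exact: mxd_jac_sym.
  rewrite [LHS]mxE [RHS]mxE.
  have E p q : \sum_c pull_conn p x b c * jac x c q =
      \sum_c \sum_a jac x a p * W' a (y x) b c * jac x c q.
    apply: eq_bigr => c _; rewrite summxE mulr_suml.
    by apply: eq_bigr => d _; congr (_ * _); exact: mxE.
  rewrite !E exchange_big; apply: eq_bigr => c _; apply: eq_bigr => d _.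
  by rewrite (tf _ _ _ _ (yVU Vx)) mulrC mulrA mulrAC.
move=> k; rewrite (Gjac x Vx) -(transform_metric _ (KL k)).
rewrite (eq_mxd oV _ Gjac Vx).
have G'y1 := mxCk1_comp_chart G'1.
rewrite (mxdM _ (mxCkM oV (mxCk_tr K1) G'y1) K1 Vx) (mxdM _ (mxCk_tr K1) G'y1 Vx).
rewrite mxd_tr (mxd_comp_chart _ G'1 Vx); congr ((_ + _ *m _) *m _ + _).
rewrite /pull_conn raddf_sum /= mulmx_suml mulmx_sumr -big_split /=.
apply: eq_bigr => a _; rewrite (met _ _ (yVU Vx)).
by rewrite linearZ /= -scalemxAl -scalemxAr -scalerDr.
Qed.

Hypothesis jac_unit : forall x, V x -> jac x \in unitmx.
Hypothesis W1 : forall i, mxCk V 1%N (W i).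
Hypothesis W'1 : forall i, mxCk U 1%N (W' i).
Hypothesis WE : forall i x, V x ->
  jac x *m W i x = mxd i jac x + pull_conn i x *m jac x.

Let entryE i b c : (fun x => pull_conn i x b c) =
  fun x => \sum_a jac x a i * W' a (y x) b c.
Proof.
by apply/funext => x; rewrite summxE; apply: eq_bigr => a _; exact: mxE.
Qed.

Lemma pull_conn_C1 i : mxCk V 1%N (pull_conn i).
Proof.
split=> b c; rewrite entryE; apply: Ck_sum => // a; apply: CkM => //.
  exact: CkW (mxCk_entry jac_C2 a i).
exact: Ck1_comp_chart (mxCk_entry (W'1 a) b c).
Qed.

Lemma mxd_pull_conn i j x : V x -> mxd i (pull_conn j) x =
  \sum_b mxd i jac x b j *: W' b (y x)
  + \sum_a \sum_b jac x a i *: (jac x b j *: mxd a (W' b) (y x)).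
Proof.
move=> Vx; apply/matrixP => c d; rewrite [LHS]mxd_entry entryE.
have dj b : derivable (fun z => jac z b j) x (evec R i).
  exact: Ck_derivable (CkW (mxCk_entry jac_C2 b j)) Vx.
have dW b := derivable_comp_chart i (mxCk_entry (W'1 b) c d) Vx.
have [_ ->] := pder_sum (index_enum 'I_n) xpredT (fun b => derivableM (dj b) (dW b).1).
rewrite exchange_big -big_split /= summxE; apply: eq_bigr => b _.
rewrite (pderM (dj b) (dW b).1) [RHS]addmxE; congr (_ + _).
  by rewrite -mxd_entry [RHS]mxE.
rewrite (dW b).2 summxE mulr_sumr; apply: eq_bigr => a _.
rewrite [RHS]mxE [X in _ = _ * X]mxE mulrCA; congr (_ * (_ * _)).
by rewrite mxd_entry.
Qed.

(** Curvature commutes with pull-back: the only extra terms contain second derivatives of [y], and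
    their symmetry removes them. *)
Lemma pull_curv i j x : V x ->
  mxd i (pull_conn j) x - mxd j (pull_conn i) x + pull_conn i x *m pull_conn j x
    - pull_conn j x *m pull_conn i x =
  \sum_a jac x a i *: \sum_b jac x b j *: curv W' a b (y x).
Proof.
move=> Vx; pose T (X : 'I_n -> 'I_n -> 'M[R]_n) :=
  \sum_a \sum_b jac x a i *: (jac x b j *: X a b).
have TDB X1 X2 X3 X4 : T X1 - T X2 + T X3 - T X4 =
    T (fun a b => X1 a b - X2 a b + X3 a b - X4 a b).
  rewrite /T -sumrB -big_split -sumrB /=; apply: eq_bigr => a _.
  rewrite -sumrB -big_split -sumrB /=; apply: eq_bigr => b _.
  by rewrite -scalerBr -scalerBr -scalerDr -scalerDr -scalerBr -scalerBr.
have cancel_sum (S A B C D : 'M[R]_n) : (S + A) - (S + B) + C - D = A - B + C - D.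
  by mxabel.
have TC X : \sum_a \sum_b jac x a j *: (jac x b i *: X a b) = T (fun a b => X b a).
  rewrite exchange_big; apply: eq_bigr => a _; apply: eq_bigr => b _.
  by rewrite !scalerA mulrC.
have pp p q : pull_conn p x *m pull_conn q x =
    \sum_a \sum_b jac x a p *: (jac x b q *: (W' a (y x) *m W' b (y x))).
  rewrite mulmx_suml; apply: eq_bigr => a _; rewrite mulmx_sumr; apply: eq_bigr => b _.
  by rewrite -scalemxAl -scalemxAr.
rewrite !mxd_pull_conn // !pp (TC (fun a b => mxd a (W' b) (y x))).
rewrite (TC (fun a b => W' a (y x) *m W' b (y x))).
have -> : \sum_b mxd j jac x b i *: W' b (y x) = \sum_b mxd i jac x b j *: W' b (y x).
  by apply: eq_bigr => b _; congr (_ *: _); exact: mxd_jac_sym.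
apply: etrans (cancel_sum _ _ _ _ _) (etrans (TDB _ _ _ _) _).
by apply: eq_bigr => a _; rewrite scaler_sumr.
Qed.

Lemma curv_transform i j x : V x -> jac x *m curv W i j x =
  (\sum_a jac x a i *: \sum_b jac x b j *: curv W' a b (y x)) *m jac x.
Proof.
move=> Vx; have K1 := mxCkW jac_C2; rewrite -(pull_curv _ _ Vx).
have dK k : mxd k jac x = jac x *m W k x - pull_conn k x *m jac x.
  by rewrite WE // addrK.
(* The derivative of the gauge relation [WE], needed in both orders of the two directions. *)
have e k l : mxd k jac x *m W l x + jac x *m mxd k (W l) x =
    mxd k (mxd l jac) x + (mxd k (pull_conn l) x *m jac x + pull_conn l x *m mxd k jac x).
  rewrite -(mxdM _ K1 (W1 l) Vx) -(mxdM _ (pull_conn_C1 l) K1 Vx).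
  rewrite -(mxdD _ (mxCk_mxd l jac_C2) (mxCkM oV (pull_conn_C1 l) K1) Vx).
  exact: (eq_mxd oV _ (WE l)).
apply: (gauge_curvature (dK i) (dK j) (e i j)).
by rewrite (mxd_sym oV i j jac_C2 Vx); exact: e.
Qed.

Lemma ricci_transform x : V x ->
  \matrix_(j, l) (\sum_k curv W k j x k l) =
  (jac x)^T *m (\matrix_(j, l) \sum_k curv W' k j (y x) k l) *m jac x.
Proof.
move=> Vx; apply/matrixP => j l; rewrite [LHS]mxE.
have E k : curv W k j x = invmx (jac x) *m
    \sum_a jac x a k *: (\sum_b jac x b j *: (curv W' a b (y x) *m jac x)).
  rewrite -[LHS](mulKmx (jac_unit Vx)) curv_transform // mulmx_suml.
  congr (_ *m _); apply: eq_bigr => a _; rewrite -scalemxAl mulmx_suml.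
  by congr (_ *: _); apply: eq_bigr => b _; rewrite -scalemxAl.
under eq_bigr do rewrite E; rewrite contract_gauge ?jac_unit //.
transitivity (\sum_a \sum_b \sum_d jac x b j * (curv W' a b (y x) a d * jac x d l)).
  apply: eq_bigr => a _; rewrite summxE; apply: eq_bigr => b _.
  by rewrite [LHS]mxE -mulr_sumr; congr (_ * _); exact: mxE.
rewrite -mulmxA [RHS]mxE exchange_big; apply: eq_bigr => b _.
rewrite exchange_big [X in _ = _ * X]mxE [X in _ = X * _]mxE mulr_sumr.
apply: eq_bigr => d _; rewrite -mulr_sumr; congr (_ * _).
by rewrite [X in _ = X * _]mxE mulr_suml.
Qed.

End TransformedConnection.
End ChangeOfCoordinates.

(** * Curvature on a manifold *)

Local Notation coord := Defs.coord.
Local Notation jacobian := Defs.jacobian.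

(* [smooth_manifold] without the Hausdorff and second countability axioms. *)
Record chart_manifold (R : realType) n (M : topologicalType) (A : atlas R n M) : Prop := {
  cm_cover : forall p : M, exists c : chart A, dom c p ;
  cm_open_dom : forall c : chart A, open (dom c) ;
  cm_open_cod : forall c : chart A, open (cod c) ;
  cm_coordK : forall (c : chart A) p, dom c p -> icoord c (coord c p) = p ;
  cm_coord_continuous : forall (c : chart A) p, dom c p -> {for p, continuous (coord c)} ;
  cm_icoord_continuous : forall (c : chart A) x, cod c x -> {for x, continuous (icoord c)} ;
  cm_smooth_transition : forall (c d : chart A) (i : 'I_n),
    smooth_on (coord c @` (dom c `&` dom d)) (fun x => coord d (icoord c x) 0 i)
}.

Lemma trace_scaled_metric (R : fieldType) n (G S : 'M[R]_n) (mu : R) :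
  G^T = G -> G \in unitmx -> S = mu *: G ->
  \sum_i \sum_j invmx G i j * S i j = n%:R * mu.
Proof.
move=> Gs Gu ->; transitivity (\sum_(i < n) mu); last first.
  by rewrite sumr_const card_ord mulr_natl.
apply: eq_bigr => i _.
have /matrixP/(_ i i) := mulVmx Gu; rewrite !mxE eqxx => E.
rewrite -[RHS]mulr1 -[X in _ = _ * X]E mulr_sumr; apply: eq_bigr => j _.
rewrite [X in _ * X = _]mxE mulrCA; congr (_ * (_ * _)).
by rewrite -[in LHS]Gs mxE.
Qed.

Section ChartGeometry.
Variables (R : realType) (n : nat) (M : topologicalType) (A : atlas R n M).
Hypothesis hM : chart_manifold A.
Variable g : tcomp A.
Hypothesis hg : pseudo_metric g.
Implicit Types (c d : chart A) (p q : M) (i j k l : 'I_n) (x : 'rV[R]_n).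

Definition metric_in_chart c : 'rV[R]_n -> 'M[R]_n := fun x => g c (icoord c x).
Local Notation G := metric_in_chart.

Lemma icoord_dom c x : cod c x -> dom c (icoord c x) /\ coord c (icoord c x) = x.
Proof. by case=> p dp <-; rewrite (cm_coordK hM). Qed.

Lemma coord_cod c p : dom c p -> cod c (coord c p).
Proof. by move=> dp; exists p. Qed.

Lemma pd_icoord c i (F : M -> R) x : cod c x ->
  pd c i F (icoord c x) = pder i (F \o icoord c) x.
Proof. by move=> /icoord_dom[_ e]; rewrite /pd e. Qed.

Lemma metric_in_chart_C3 c : mxCk (cod c) 3%N (G c).
Proof. by split=> i j; exact: (metric_smooth hg c i j). Qed.

Lemma metric_in_chart_sym c x : cod c x -> (G c x)^T = G c x.
Proof. by move=> /icoord_dom[dx _]; exact: (Defs.metric_sym hg dx). Qed.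

Lemma metric_in_chart_unit c x : cod c x -> G c x \in unitmx.
Proof. by move=> /icoord_dom[dx _]; exact: (metric_nondeg hg dx). Qed.

Lemma christoffel_icoord c k i j x : cod c x ->
  christoffel g c k i j (icoord c x) = lchr (G c) k i j x.
Proof.
move=> cx; rewrite /christoffel /lchr; congr (_ * _); apply: eq_bigr => l _.
by rewrite !pd_icoord.
Qed.

Lemma riemann_icoord c k l i j x : cod c x ->
  riemann g c k l i j (icoord c x) = curv (conn (G c)) i j x k l.
Proof.
move=> cx; have oc : open (cod c) := @cm_open_cod _ _ _ _ hM c.
have dC a m b : pd c a (christoffel g c k m b) (icoord c x) =
    mxd a (conn (G c) m) x k b.
  rewrite pd_icoord // mxd_entry; apply: (eq_pder _ oc) cx => z cz /=.
  by rewrite christoffel_icoord // mxE.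
rewrite /riemann /curv !addmxE !oppmxE !dC big_split /= sumrN addrA.
congr (_ + _ - _); rewrite [RHS]mxE; apply: eq_bigr => m _.
  by rewrite !christoffel_icoord // [X in _ = X * _]mxE [X in _ = _ * X]mxE.
by rewrite !christoffel_icoord // [X in _ = X * _]mxE [X in _ = _ * X]mxE.
Qed.

Lemma ricci_icoord c x : cod c x -> ricci g c (icoord c x) = lric (G c) x.
Proof.
move=> cx; apply/matrixP => j l; rewrite [LHS]mxE [RHS]mxE.
by apply: eq_bigr => k _; exact: riemann_icoord.
Qed.

Lemma ricci_factor_locally_constant c (mu : M -> R) p : (3 <= n)%N ->
  (forall q, dom c q -> ricci g c q = mu q *: g c q) -> dom c p ->
  \forall q \near p, mu q = mu p.
Proof.
move=> n3 einst dp; have oc : open (cod c) := @cm_open_cod _ _ _ _ hM c.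
have einst' x : cod c x -> lric (G c) x = mu (icoord c x) *: G c x.
  by move=> cx; rewrite -ricci_icoord // einst //; have [] := icoord_dom cx.
have n0 : n%:R != 0 :> R by rewrite pnatr_eq0 -lt0n; exact: leq_trans n3.
(* No regularity of [mu] is assumed; it is 1/n times the trace of the Ricci matrix, which is C^1. *)
have mu1 : Ck (cod c) 1%N (fun x => mu (icoord c x)).
  apply: (@eq_Ck _ _ _ _ (fun x =>
    n%:R^-1 * \sum_i \sum_j invmx (G c x) i j * lric (G c) x i j)) => //.
    move=> x cx; rewrite (trace_scaled_metric (metric_in_chart_sym cx) (metric_in_chart_unit cx) (einst' x cx)).
    by rewrite mulKf.
  apply: CkM => //; first exact: Ck_cst.
  apply: Ck_sum => // i; apply: Ck_sum => // j; apply: CkM => //.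
    exact: CkW (CkW (mxCk_entry (mxCk_invmx oc (metric_in_chart_C3 c) (@metric_in_chart_unit c)) i j)).
  rewrite (_ : (fun x => _) = fun x => \sum_k curv (conn (G c)) k i x k j).
    by apply: Ck_sum => // k; exact: mxCk_entry (Ck_curv oc (metric_in_chart_C3 c) (@metric_in_chart_unit c) k i) k j.
  by apply/funext => x; rewrite mxE.
have dmu m x : cod c x -> pder m (fun x => mu (icoord c x)) x = 0.
  move=> cx; apply: (@schur_local R n (cod c) oc (G c) (conn (G c)) (curv (conn (G c)))
    (mxCkW (metric_in_chart_C3 c)) (@metric_in_chart_sym c) (@metric_in_chart_unit c) (Ck_conn oc (metric_in_chart_C3 c) (@metric_in_chart_unit c))
    (conn_torsion_free oc (@metric_in_chart_sym c)) (conn_metric oc (@metric_in_chart_sym c) (@metric_in_chart_unit c))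
    _ _ m x n3 mu1 einst' cx).
  by move=> *; exact: curvE.
have lc := pder0_locally_constant oc mu1 (coord_cod dp) dmu.
have np : \forall q \near p, dom c q by exact: open_nbhs_nbhs (conj (@cm_open_dom _ _ _ _ hM c) dp).
have cp := cm_coord_continuous hM dp.
have := cp _ lc; rewrite /= => lcp.
near=> q.
have dq : dom c q by near: q.
rewrite -{1}(cm_coordK hM dq) -[in RHS](cm_coordK hM dp).
by near: q.
Unshelve. all: by end_near. Qed.

(** * Tensoriality of the Ricci curvature on the overlap of two charts *)

Section Overlap.
Variables c d : chart A.

(** Described by a preimage rather than by the image in [cm_smooth_transition], so that openness
    follows from continuity of [icoord c]. *)
Let overlap : set 'rV[R]_n := cod c `&` icoord c @^-1` dom d.
Let y : 'rV[R]_n -> 'rV[R]_n := fun x => coord d (icoord c x).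

Let open_overlap : open overlap.
Proof.
rewrite openE => x [cx dx]; apply: filterI.
  exact: open_nbhs_nbhs (conj (@cm_open_cod _ _ _ _ hM c) cx).
apply: (cm_icoord_continuous hM cx).
exact: open_nbhs_nbhs (conj (@cm_open_dom _ _ _ _ hM d) dx).
Qed.

Let y3 a : Ck overlap 3%N (fun x => y x 0 a).
Proof.
apply: (@Ck_subset _ _ (coord c @` (dom c `&` dom d))).
  move=> x [cx dx]; have [cx' e] := icoord_dom cx.
  by exists (icoord c x).
exact: (cm_smooth_transition hM c d a).
Qed.

Let y_cod x : overlap x -> cod d (y x).
Proof. by case=> _ /coord_cod. Qed.

Let icoord_y x : overlap x -> icoord d (y x) = icoord c x.
Proof. by case=> _ dx; exact: (cm_coordK hM dx). Qed.

Lemma jac_jacobian x : cod c x -> dom d (icoord c x) ->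
  (jac y x)^T = jacobian c d (icoord c x).
Proof.
move=> cx dx; apply/matrixP => i a; rewrite [LHS]mxE [LHS]mxE [RHS]mxE.
by rewrite pd_icoord.
Qed.

Let metric_overlap x : overlap x ->
  G c x = (jac y x)^T *m G d (y x) *m jac y x.
Proof.
move=> ox; have [cx dx] := ox; have [cx' _] := icoord_dom cx.
rewrite -[jac y x in X in _ *m X]trmxK jac_jacobian //.
by rewrite /metric_in_chart icoord_y //; exact: (metric_tensor hg cx' dx).
Qed.

(** Read off from the metric: the Jacobian is a factor of the invertible matrix [G c x]. *)
Let jac_unit x : overlap x -> jac y x \in unitmx.
Proof.
move=> ox; have := metric_in_chart_unit ox.1; rewrite (metric_overlap ox).
by rewrite unitmx_mul => /andP[].
Qed.

Lemma ricci_overlap p : dom c p -> dom d p ->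
  ricci g c p = jacobian c d p *m ricci g d p *m (jacobian c d p)^T.
Proof.
move=> cp dp; have cx := coord_cod cp; have e := cm_coordK hM cp.
have ox : overlap (coord c p) by split=> //=; rewrite e.
have oc : open (cod c) := @cm_open_cod _ _ _ _ hM c.
have od : open (cod d) := @cm_open_cod _ _ _ _ hM d.
have Wc i : mxCk overlap 1%N (conn (G c) i).
  split=> a b; apply: (@Ck_subset _ _ (cod c)); first by move=> x [].
  exact: mxCk_entry (mxCkW (Ck_conn oc (metric_in_chart_C3 c) (@metric_in_chart_unit c) i)) a b.
have Wd i : mxCk (cod d) 1%N (conn (G d) i).
  exact: mxCkW (Ck_conn od (metric_in_chart_C3 d) (@metric_in_chart_unit d) i).
have WE := conn_transform open_overlap od y3 y_cod
  (fun x (ox : overlap x) => metric_in_chart_sym ox.1) (fun x (ox : overlap x) => metric_in_chart_unit ox.1)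
  metric_overlap jac_unit (mxCkW (mxCkW (metric_in_chart_C3 d)))
  (conn_torsion_free od (@metric_in_chart_sym d)) (conn_metric od (@metric_in_chart_sym d) (@metric_in_chart_unit d)).
have E : lric (G c) (coord c p) = (jac y (coord c p))^T *m
    lric (G d) (y (coord c p)) *m jac y (coord c p) :=
  ricci_transform open_overlap od y3 y_cod jac_unit Wc Wd WE ox.
have ep : ricci g d (icoord d (y (coord c p))) = ricci g d p.
  by rewrite (icoord_y ox) e.
have eJ : (jac y (coord c p))^T = jacobian c d p.
  by rewrite jac_jacobian ?e.
rewrite -[in LHS]e (ricci_icoord cx) E -(ricci_icoord (y_cod ox)) ep eJ.
by rewrite -eJ trmxK.
Qed.

End Overlap.

Lemma ricci_tensor : tensor_field (ricci g).
Proof. by move=> c d p; exact: ricci_overlap. Qed.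

Theorem schur_constant (mu : chart A -> M -> R) : (3 <= n)%N ->
  connected [set: M] ->
  (forall c p, dom c p -> ricci g c p = mu c p *: g c p) ->
  exists k : R, forall c p, dom c p -> mu c p = k.
Proof.
move=> n3 conM einst.
have indep c d p : dom c p -> dom d p -> mu c p = mu d p.
  move=> cp dp; have E : mu c p *: g c p = mu d p *: g c p.
    rewrite -einst // (ricci_tensor cp dp) einst // -scalemxAr -scalemxAl.
    by rewrite -(metric_tensor hg cp dp).
  have := Defs.metric_nondeg hg cp; move: E => /eqP.
  rewrite -subr_eq0 -scalerBl scaler_eq0 => /orP[|/eqP ->].
    by rewrite subr_eq0 => /eqP.
  (* The metric cannot vanish at [p]: a zero matrix of positive size has determinant 0. *)
  case: (n) n3 => // m _; rewrite unitmxE det0 ?unitr0 //.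
have [[p0 _]|M0] := pselect ([set: M] !=set0); last first.
  by exists 0 => c p _; case: M0; exists p.
pose chart_at p := projT1 (cid (cm_cover hM p)).
have chart_atP p : dom (chart_at p) p := projT2 (cid (cm_cover hM p)).
pose m p := mu (chart_at p) p.
have mE c p : dom c p -> mu c p = m p by move=> cp; exact: indep.
have m_loc p : \forall q \near p, m q = m p.
  apply: (@ricci_factor_locally_constant (chart_at p)) => // q dq.
  by rewrite einst // mE.
suff m_const p : m p = m p0 by exists (m p0) => c p cp; rewrite mE.
(* Local constancy makes [B] and its complement open. *)
pose B := [set q | m q = m p0].
suff : B = [set: M] by move=> /seteqP[_ /(_ p I)].
apply: conM; first by exists p0.
  exists B; last by rewrite setTI.
  by rewrite openE => q Bq; apply: filterS (m_loc q) => r; rewrite /B /= => ->.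
exists B; last by rewrite setTI.
rewrite -openC openE => q Bq; apply: filterS (m_loc q) => r; rewrite /B /=.
by move=> -> /Bq.
Qed.

End ChartGeometry.

(** * Product charts *)

Section CoordinateProjection.
Variables (R : realType) (m n : nat) (L : {linear 'rV[R]_m -> 'rV[R]_n}).
Implicit Types (h : 'rV[R]_n -> R) (i : 'I_m) (j : 'I_n).

Let growth h v x (u : R) : (h \o L) (u *: v + x) = h (u *: L v + L x).
Proof. by rewrite /= linearP. Qed.

Lemma derivable_comp_linear h v x : derivable (h \o L) x v = derivable h (L x) (L v).
Proof. by have [-> _] := eq_growth_derive (growth h v x). Qed.

Lemma derive_comp_linear h v x : 'D_v (h \o L) x = 'D_(L v) h (L x).
Proof. by have [_ ->] := eq_growth_derive (growth h v x). Qed.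

Lemma pder_comp_proj h i j : L (evec R i) = evec R j ->
  pder i (h \o L) = pder j h \o L.
Proof. by move=> Le; apply/funext => x; rewrite /pder derive_comp_linear Le. Qed.

Lemma pder_comp_proj0 h i : L (evec R i) = 0 -> pder i (h \o L) = fun=> 0.
Proof. by move=> Le; apply/funext => x; rewrite /pder derive_comp_linear Le derive0. Qed.

(** Each partial derivative of [h \o L] is 0 or again a partial derivative of [h] composed with [L],
    so the induction on [k] stays within such composites. *)
Lemma Ck_comp_proj (U : set 'rV[R]_n) (V : set 'rV[R]_m) k h :
  continuous L -> (forall i, L (evec R i) = 0 \/ exists j, L (evec R i) = evec R j) ->
  (forall x, V x -> U (L x)) -> Ck U k h -> Ck V k (h \o L).
Proof.
move=> cL projL VU; elim: k h => [|k IH] h hk.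
  apply/Ck0P => x Vx.
  exact: (continuous_comp (cL x) (Ck_continuous hk (VU x Vx))).
have [_ dh] := (CkSP _ _ _).1 hk; apply/CkSP; split=> [x Vx|i].
  exact: (continuous_comp (cL x) (Ck_continuous hk (VU x Vx))).
have [Le|[j Le]] := projL i.
  split=> [x Vx|]; last by rewrite (pder_comp_proj0 _ Le); exact: Ck_cst.
  by rewrite derivable_comp_linear Le; exact: derivable0.
split=> [x Vx|]; last by rewrite (pder_comp_proj _ Le); apply: IH; exact: (dh j).2.
by rewrite derivable_comp_linear Le; exact: (dh j).1 (VU x Vx).
Qed.

End CoordinateProjection.

Section BlockProjections.
Variables (R : realType) (n1 n2 : nat).

Lemma lsubmx_evec_l (i : 'I_n1) : lsubmx (evec R (lshift n2 i)) = evec R i.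
Proof. by apply/rowP => j; rewrite !mxE (inj_eq (@lshift_inj _ _)). Qed.

Lemma lsubmx_evec_r (i : 'I_n2) : lsubmx (evec R (rshift n1 i)) = 0.
Proof. by apply/rowP => j; rewrite !mxE eq_lrshift. Qed.

Lemma rsubmx_evec_r (i : 'I_n2) : rsubmx (evec R (rshift n1 i)) = evec R i.
Proof. by apply/rowP => j; rewrite !mxE (inj_eq (@rshift_inj _ _)). Qed.

Lemma rsubmx_evec_l (i : 'I_n1) : rsubmx (evec R (lshift n2 i)) = 0.
Proof. by apply/rowP => j; rewrite !mxE eq_rlshift. Qed.

Lemma Ck_comp_lsubmx (U : set 'rV[R]_n1) (V : set 'rV[R]_(n1 + n2)) k h :
  (forall x, V x -> U (lsubmx x)) -> Ck U k h -> Ck V k (fun x => h (lsubmx x)).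
Proof.
apply: (@Ck_comp_proj R _ _ (@lsubmx R 1 n1 n2)).
  exact: continuous_lsubmx.
move=> i; case: (split_ordP i) => j -> /=.
  by right; exists j; exact: lsubmx_evec_l.
by left; exact: lsubmx_evec_r.
Qed.

Lemma Ck_comp_rsubmx (U : set 'rV[R]_n2) (V : set 'rV[R]_(n1 + n2)) k h :
  (forall x, V x -> U (rsubmx x)) -> Ck U k h -> Ck V k (fun x => h (rsubmx x)).
Proof.
apply: (@Ck_comp_proj R _ _ (@rsubmx R 1 n1 n2)).
  exact: continuous_rsubmx.
move=> i; case: (split_ordP i) => j -> /=.
  by left; exact: rsubmx_evec_l.
by right; exists j; exact: rsubmx_evec_r.
Qed.

Lemma continuous_row_mx (T : topologicalType) (u : T -> 'rV[R]_n1) (v : T -> 'rV[R]_n2) t :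
  {for t, continuous u} -> {for t, continuous v} ->
  {for t, continuous (fun s => row_mx (u s) (v s))}.
Proof.
have Ft : Filter (nbhs t) by exact: nbhs_filter.
move=> /(@cvgrPdist_le _ _ _ _ Ft) cu /(@cvgrPdist_le _ _ _ _ Ft) cv.
apply/(@cvgrPdist_le _ _ _ _ Ft) => e e0.
apply: filterS2 (cu e e0) (cv e e0) => s us vs; apply: rV_norm_le; first exact: ltW.
move=> j; rewrite addmxE oppmxE; case: (split_ordP j) => i -> /=.
  rewrite !row_mxEl -oppmxE -addmxE; exact: le_trans (ler_rV_norm _ _) us.
rewrite !row_mxEr -oppmxE -addmxE; exact: le_trans (ler_rV_norm _ _) vs.
Qed.

End BlockProjections.

Section ProductAtlas.
Variables (R : realType) (n1 n2 : nat) (M1 M2 : topologicalType).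
Variables (A1 : atlas R n1 M1) (A2 : atlas R n2 M2).
Local Notation A := (prod_atlas A1 A2).
Implicit Types (c d : chart A).

Lemma prod_codE c x : cod c x <-> cod c.1 (lsubmx x) /\ cod c.2 (rsubmx x).
Proof.
split=> [[p [d1 d2] <-]|[[p1 d1 e1] [p2 d2 e2]]] /=.
  by rewrite row_mxKl row_mxKr; split; [exists p.1|exists p.2].
by exists (p1, p2) => //=; rewrite e1 e2 hsubmxK.
Qed.

Lemma prod_chart_manifold : smooth_manifold A1 -> smooth_manifold A2 -> chart_manifold A.
Proof.
move=> h1 h2; split.
- move=> p; have [c1 d1] := manifold_cover h1 p.1; have [c2 d2] := manifold_cover h2 p.2.
  by exists (c1, c2).
- move=> c; rewrite openE => p [d1 d2]; exists (dom c.1, dom c.2) => //=.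
  split; [exact: open_nbhs_nbhs (conj (@open_dom _ _ _ _ h1 c.1) d1)|
          exact: open_nbhs_nbhs (conj (@open_dom _ _ _ _ h2 c.2) d2)].
- move=> c; rewrite (_ : cod c = (@lsubmx R 1 n1 n2) @^-1` cod c.1 `&`
      (@rsubmx R 1 n1 n2) @^-1` cod c.2); last first.
    by apply/seteqP; split=> x; move=> /prod_codE.
  apply: openI; apply: open_comp.
  + by move=> x _; exact: continuous_lsubmx.
  + exact: (open_cod h1).
  + by move=> x _; exact: continuous_rsubmx.
  + exact: (open_cod h2).
- move=> c [p1 p2] [/= d1 d2]; rewrite row_mxKl row_mxKr.
  by rewrite (coordK h1) ?(coordK h2) ?inE.
- move=> c p [d1 d2]; apply: continuous_row_mx.
    apply: (@continuous_comp _ _ _ fst (coord c.1) p); first exact: cvg_fst.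
    by apply: (Defs.coord_continuous h1); rewrite inE.
  apply: (@continuous_comp _ _ _ snd (coord c.2) p); first exact: cvg_snd.
  by apply: (Defs.coord_continuous h2); rewrite inE.
- move=> c x /prod_codE[c1 c2].
  have i1 : {for x, continuous (fun z => icoord c.1 (@lsubmx R 1 n1 n2 z))}.
    apply: (@continuous_comp _ _ _ lsubmx (icoord c.1) x); first exact: continuous_lsubmx.
    by apply: (icoord_continuous h1); rewrite inE.
  have i2 : {for x, continuous (fun z => icoord c.2 (@rsubmx R 1 n1 n2 z))}.
    apply: (@continuous_comp _ _ _ rsubmx (icoord c.2) x); first exact: continuous_rsubmx.
    by apply: (icoord_continuous h2); rewrite inE.
  exact: (cvg_pair i1 i2).
- move=> c d i k; case: (split_ordP i) => j -> /=.
    rewrite (_ : (fun x => _) = fun x => coord d.1 (icoord c.1 (lsubmx x)) 0 j); last first.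
      by apply/funext => x; rewrite row_mxEl.
    apply: (@Ck_comp_lsubmx R n1 n2 _ _ k (fun x => coord d.1 (icoord c.1 x) 0 j) _
      (smooth_transition h1 c.1 d.1 j k)).
    by move=> _ [p [[p1 p2] [q1 q2]] <-] /=; rewrite row_mxKl; exists p.1.
  rewrite (_ : (fun x => _) = fun x => coord d.2 (icoord c.2 (rsubmx x)) 0 j); last first.
    by apply/funext => x; rewrite row_mxEr.
  apply: (@Ck_comp_rsubmx R n1 n2 _ _ k (fun x => coord d.2 (icoord c.2 x) 0 j) _
    (smooth_transition h2 c.2 d.2 j k)).
  by move=> _ [p [[p1 p2] [q1 q2]] <-] /=; rewrite row_mxKr; exists p.2.
Qed.

End ProductAtlas.

(** * The Lyra metric *)

Section LyraMetric.
Variables (R : realType) (n1 n2 : nat) (M1 M2 : topologicalType).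
Variables (A1 : atlas R n1 M1) (A2 : atlas R n2 M2).
Local Notation A := (prod_atlas A1 A2).
Implicit Types (c d : chart A).

Lemma prod_jacobian c d p : dom c p ->
  jacobian c d p =
  block_mx (jacobian c.1 d.1 p.1) 0 0 (jacobian c.2 d.2 p.2).
Proof.
move=> cp; apply/matrixP => i a; rewrite [LHS]mxE /pd.
set x := coord c p.
have xl : lsubmx x = coord c.1 p.1 by rewrite row_mxKl.
have xr : rsubmx x = coord c.2 p.2 by rewrite row_mxKr.
case: (split_ordP a) => b ->.
  rewrite (_ : _ \o icoord c =
    (fun z => coord d.1 (icoord c.1 z) 0 b) \o (@lsubmx R 1 n1 n2)); last first.
    by apply/funext => z /=; rewrite row_mxEl.
  rewrite derive_comp_linear /= xl; case: (split_ordP i) => j ->.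
    by rewrite block_mxEul lsubmx_evec_l [RHS]mxE.
  by rewrite block_mxEdl lsubmx_evec_r derive0 mxE.
rewrite (_ : _ \o icoord c =
  (fun z => coord d.2 (icoord c.2 z) 0 b) \o (@rsubmx R 1 n1 n2)); last first.
  by apply/funext => z /=; rewrite row_mxEr.
rewrite derive_comp_linear /= xr; case: (split_ordP i) => j ->.
  by rewrite block_mxEur rsubmx_evec_l derive0 mxE.
by rewrite block_mxEdr rsubmx_evec_r [RHS]mxE.
Qed.

Lemma lyra_pseudo_metric (g1 : tcomp A1) (g2 : tcomp A2) (f phi : M1 * M2 -> R) :
  chart_manifold A -> pseudo_metric g1 -> pseudo_metric g2 ->
  smooth_fun A f -> (forall p, 0 < f p) -> smooth_fun A phi -> (forall p, 0 < phi p) ->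
  pseudo_metric (lyra_metric g1 g2 f phi).
Proof.
move=> hM h1 h2 sf f0 sphi phi0; split.
- move=> c d p cp dp; have [c1 c2] := cp; have [d1 d2] := dp.
  rewrite prod_jacobian // /lyra_metric /scale_tensor /twisted_product.
  rewrite -scalemxAr -scalemxAl; congr (_ *: _).
  rewrite tr_block_mx !mulmx_block !trmx0.
  rewrite !(mulmx0, mul0mx, addr0, add0r) -scalemxAr -scalemxAl.
  by rewrite (metric_tensor h1 c1 d1) (metric_tensor h2 c2 d2).
- move=> c i j k; have oc : open (cod c) := @cm_open_cod _ _ _ _ hM c.
  have sq (F : M1 * M2 -> R) : smooth_fun A F -> Ck (cod c) k (fun x => F (icoord c x) ^+ 2).
    by move=> /(_ c k) Fk; under eq_fun do rewrite expr2; exact: CkM.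
  rewrite (_ : _ \o _ = fun x => phi (icoord c x) ^+ 2 *
      twisted_product g1 g2 f c (icoord c x) i j); last first.
    by apply/funext => x; rewrite /= [LHS]mxE.
  apply: CkM => //; first exact: sq.
  case: (split_ordP i) => i' ->; case: (split_ordP j) => j' ->.
  + rewrite (_ : (fun x => _) = fun x => g1 c.1 (icoord c.1 (lsubmx x)) i' j'); last first.
      by apply/funext => x; rewrite [LHS]block_mxEul.
    apply: (@Ck_comp_lsubmx R n1 n2 _ _ k (fun x => g1 c.1 (icoord c.1 x) i' j') _
      (metric_smooth h1 c.1 i' j' k)).
    by move=> x /prod_codE[].
  + rewrite (_ : (fun x => _) = fun=> 0); first exact: Ck_cst.
    by apply/funext => x; rewrite [LHS]block_mxEur mxE.
  + rewrite (_ : (fun x => _) = fun=> 0); first exact: Ck_cst.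
    by apply/funext => x; rewrite [LHS]block_mxEdl mxE.
  rewrite (_ : (fun x => _) = fun x => f (icoord c x) ^+ 2 *
      g2 c.2 (icoord c.2 (rsubmx x)) i' j'); last first.
    by apply/funext => x; rewrite [LHS]block_mxEdr mxE.
  apply: CkM => //; first exact: sq.
  apply: (@Ck_comp_rsubmx R n1 n2 _ _ k (fun x => g2 c.2 (icoord c.2 x) i' j') _
    (metric_smooth h2 c.2 i' j' k)).
  by move=> x /prod_codE[].
- move=> c p [c1 c2]; rewrite /lyra_metric /scale_tensor /twisted_product.
  have trZ m (a : R) (B : 'M[R]_m) : (a *: B)^T = a *: B^T by exact: linearZ.
  by rewrite trZ tr_block_mx !trmx0 trZ (Defs.metric_sym h1 c1) (Defs.metric_sym h2 c2).
- move=> c p [c1 c2]; have := metric_nondeg h1 c1; have := metric_nondeg h2 c2.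
  rewrite !unitmxE !unitfE => u2 u1.
  rewrite detZ det_ublock detZ !mulf_neq0 // ?expf_neq0 //.
  + by rewrite gt_eqF.
  + by rewrite gt_eqF.
Qed.

End LyraMetric.

(** * From the soliton equation to the Einstein condition and back *)

Theorem theorem5p1 (R : realType) (n1 n2 : nat) (M1 M2 : topologicalType)
    (A1 : atlas R n1 M1) (A2 : atlas R n2 M2)
    (g1 : tcomp A1) (g2 : tcomp A2) (f phi : M1 * M2 -> R)
    (Z : vcomp (prod_atlas A1 A2)) (lambda : M1 * M2 -> R) (rho : R)
    (hn1 : (0 < n1)%N) (hn2 : (0 < n2)%N) (hn : (3 <= n1 + n2)%N)
    (hM1 : smooth_manifold A1) (hM2 : smooth_manifold A2)
    (hconn : connected [set: M1 * M2])
    (hg1 : pseudo_metric g1) (hg2 : pseudo_metric g2)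
    (hf : smooth_fun (prod_atlas A1 A2) f) (hf0 : forall p, 0 < f p)
    (hphi : smooth_fun (prod_atlas A1 A2) phi) (hphi0 : forall p, 0 < phi p)
    (gL := lyra_metric g1 g2 f phi)
    (hsol : almost_ricci_bourguignon_soliton gL Z lambda rho) :
  (conformal gL Z <-> einstein gL) /\
  (forall psi : M1 * M2 -> R, conformal_factor gL Z psi ->
     exists mu : R,
       tensor_eq (ricci gL) (scale_tensor (fun=> mu) gL) /\
       forall (c : chart (prod_atlas A1 A2)) (p : M1 * M2), dom c p ->
         [/\ mu = lambda p + rho * scalar_curv gL c p - psi p,
             scalar_curv gL c p = (n1 + n2)%:R * mu &
             lambda p = (1 - (n1 + n2)%:R * rho) * mu + psi p]).
Proof.
have hM := prod_chart_manifold hM1 hM2.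
have hg : pseudo_metric gL by exact: lyra_pseudo_metric.
have n0 : (n1 + n2)%:R != 0 :> R by rewrite pnatr_eq0 -lt0n ltn_addr.
have scalE (c : chart (prod_atlas A1 A2)) p (mu : R) : dom c p ->
    ricci gL c p = mu *: gL c p -> scalar_curv gL c p = (n1 + n2)%:R * mu.
  move=> cp; exact: trace_scaled_metric (Defs.metric_sym hg cp) (metric_nondeg hg cp).
have main (psi : M1 * M2 -> R) : conformal_factor gL Z psi ->
     exists mu : R,
       tensor_eq (ricci gL) (scale_tensor (fun=> mu) gL) /\
       forall (c : chart (prod_atlas A1 A2)) (p : M1 * M2), dom c p ->
         [/\ mu = lambda p + rho * scalar_curv gL c p - psi p,
             scalar_curv gL c p = (n1 + n2)%:R * mu &
             lambda p = (1 - (n1 + n2)%:R * rho) * mu + psi p].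
  move=> [_ lie].
  (* The factor keeps its chart argument because [scalar_curv] has one; [schur_constant] removes
     it. *)
  pose mu (c : chart (prod_atlas A1 A2)) p := lambda p + rho * scalar_curv gL c p - psi p.
  have einst c p : dom c p -> ricci gL c p = mu c p *: gL c p.
    move=> cp; rewrite /mu scalerBl -(soliton_eq hsol cp) (lie c p cp) /scale_tensor.
    by rewrite scalerA mulrA mulVf ?mul1r ?addrK // pnatr_eq0.
  have [k muk] := schur_constant hM hg hn hconn einst.
  have ric c p : dom c p -> ricci gL c p = k *: gL c p.
    by move=> cp; rewrite einst // muk.
  exists k; split=> // c p cp; have S := scalE c p k cp (ric c p cp).
  have := muk c p cp; rewrite /mu S => E; split=> //.
  rewrite -[LHS](addrK (rho * ((n1 + n2)%:R * k))) -[X in X - _](subrK (psi p)) E.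
  by ring.
split=> //; split=> [[psi /main[mu [einst _]]]|[mu einst]]; first by exists mu.
(* Since the scalar curvature is the constant n mu, this factor is [lambda] plus a constant, hence
   smooth. *)
exists (fun p => lambda p + (rho * ((n1 + n2)%:R * mu) - mu)); split.
  move=> c k; apply: (CkD (@cm_open_cod _ _ _ _ hM c)); last exact: Ck_cst.
  exact: (soliton_fun hsol).
move=> c p cp; have ric : ricci gL c p = mu *: gL c p := einst c p cp.
have := soliton_eq hsol cp; rewrite (scalE c p mu cp ric) ric /scale_tensor => E.
have half : 2^-1 *: lie_derivative Z gL c p =
    (lambda p + (rho * ((n1 + n2)%:R * mu) - mu)) *: gL c p.
  by rewrite addrA scalerBl -E addrAC subrr add0r.
by rewrite -scalerA -half scalerA mulfV ?scale1r // pnatr_eq0.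
Qed.
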